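(* Let smooth initial data (M) for a Moutard net in $\mathbb{R}^N$ be given, and let $f^\epsilon$ be the corresponding canonical discrete M-nets. Then for some $r>0$ the canonical discrete M-nets $f^\epsilon:\mathcal{B}^\epsilon(r)\to\mathbb{R}^N$ converge, as $\epsilon\to 0$, to the unique M-net $f:\mathcal{B}(r)\to\mathbb{R}^N$ with the initial data (M). The convergence is with the order $O(\epsilon)$ in $C^\infty(\mathcal{B}(r))$.
   Context: Put $\mathcal{B}_1=\mathbb{R}\times\{0\}$, $\mathcal{B}_2=\{0\}\times\mathbb{R}$, $\mathcal{B}(r)=[0,r]^2$, $\mathcal{B}^\epsilon(r)=(\epsilon\mathbb{Z})^2\cap[0,r]^2$, $\mathcal{B}_i^\epsilon=\mathcal{B}_i\cap(\epsilon\mathbb{Z})^2$. On $(\epsilon\mathbb{Z})^2$: $(\tau_i f)(u)=f(u+\epsilon e_i)$, $\delta_i=\epsilon^{-1}(\tau_i-1)$, $\delta^\alpha=\delta_1^{\alpha_1}\delta_2^{\alpha_2}$. An M-net (Moutard net) is a map $f$ of two real variables with values in $\mathbb{R}^N$ satisfying $\partial_1\partial_2 f=q_{12}f$ with a real function $q_{12}$. Initial data (M): two smooth curves $f|_{\mathcal{B}_1}$, $f|_{\mathcal{B}_2}$ in $\mathbb{R}^N$ with a common point $f(0)$, and a smooth function $q_{12}:\mathbb{R}^2\to\mathbb{R}$ (the coefficient of the Moutard equation). A discrete M-net is a map $f^\epsilon:(\epsilon\mathbb{Z})^2\to\mathbb{R}^N$ with $\tau_1\tau_2f^\epsilon+f^\epsilon=a^\epsilon_{12}(\tau_1f^\epsilon+\tau_2f^\epsilon)$.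 The canonical discrete M-nets for (M) are the solutions with $f^\epsilon(u)=f(u)$ for $u\in\mathcal{B}_i^\epsilon$, $i=1,2$, and $a_{12}^\epsilon(u)=1+\frac12\epsilon^2q_{12}(u)$ for $u\in(\epsilon\mathbb{Z})^2$. Convergence $f^\epsilon\to f$ with the order $O(\epsilon)$ in $C^\infty(\mathcal{B}(r))$ means: for every multi-index $\alpha$ there is $c_\alpha$ such that $|\delta^\alpha(f^\epsilon-f)(u)|\le c_\alpha\epsilon$ for all sufficiently small $\epsilon>0$ and all $u\in\mathcal{B}^\epsilon(r)$ at which this difference quotient is defined on $\mathcal{B}^\epsilon(r)$. *)

(* Defs.v *)
From mathcomp Require Import all_boot all_order all_algebra.
From mathcomp Require Import all_classical all_reals all_analysis.

Set Implicit Arguments.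
Unset Strict Implicit.
Unset Printing Implicit Defensive.

Import Order.TTheory GRing.Theory Num.Theory.
Import numFieldNormedType.Exports.

Local Open Scope classical_set_scope.
Local Open Scope ring_scope.

Variant axis := axis1 | axis2.

Section Plane.
Context {R : realType}.
Implicit Types (u : R * R) (i : axis) (r eps : R).

Definition unit_vec i : R * R :=
  match i with axis1 => (1, 0) | axis2 => (0, 1) end.

Definition axis_line i : set (R * R) :=
  match i with
  | axis1 => [set u | u.2 = 0]
  | axis2 => [set u | u.1 = 0]
  end.

Definition square r : set (R * R) :=
  [set u | 0 <= u.1 <= r /\ 0 <= u.2 <= r].

Definition lattice eps : set (R * R) :=
  [set u | exists m n : int, u = (eps * m%:~R, eps * n%:~R)].

Definition lattice_square eps r : set (R * R) := lattice eps `&` square r.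

End Plane.

Section Smoothness.
Context {R : realType} {W : normedModType R}.

Definition smooth_curve (c : R -> W) : Prop :=
  forall (n : nat) (t : R), derivable (derive1n n c) t 1.

Definition partial (i : axis) (F : R * R -> W) : R * R -> W := 'D_(unit_vec i) F.

Definition partials (w : seq axis) (F : R * R -> W) : R * R -> W :=
  foldr partial F w.

(* C^oo on U, meant for U open: all iterated partial derivatives, in any
   order, exist and are continuous at every point of U. *)
Definition smooth_on (U : set (R * R)) (F : R * R -> W) : Prop :=
  forall (w : seq axis) (u : R * R), U u ->
    (forall i : axis, derivable (partials w F) u (unit_vec i)) /\
    {for u, continuous (partials w F)}.

End Smoothness.

Section MoutardNets.
Context {R : realType} {N : nat}.
Implicit Types (D : set (R * R)) (q : R * R -> R).
Implicit Types (f g : R * R -> 'rV[R]_N) (c : R -> 'rV[R]_N).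

(* D need not be open, and values of f outside D are irrelevant: smoothness
   on D means having a smooth extension F to an open neighbourhood of D.  When
   D is contained in the closure of its interior (e.g. D = square r, r > 0) the
   derivatives of F on D do not depend on the choice of F. *)
Definition Mnet D q f : Prop :=
  exists (U : set (R * R)) (F : R * R -> 'rV[R]_N),
    [/\ open U, D `<=` U, smooth_on U F,
        (forall u, D u -> F u = f u)
      & (forall u, D u -> partial axis1 (partial axis2 F) u = q u *: F u)].

(* f has the values prescribed by the curves c1, c2 on the coordinate axes,
   as far as these belong to D. *)
Definition axis_data D c1 c2 f : Prop :=
  (forall u, D u -> axis_line axis1 u -> f u = c1 u.1) /\
  (forall u, D u -> axis_line axis2 u -> f u = c2 u.2).

Definition Mnet_with_data D c1 c2 q f : Prop :=
  Mnet D q f /\ axis_data D c1 c2 f.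

(* Maps on the lattice of mesh eps are represented by maps on the whole plane,
   of which only the values at lattice points are ever used. *)
Definition tau (eps : R) (i : axis) f : R * R -> 'rV[R]_N :=
  fun u => f (u + eps *: unit_vec i).

Definition delta (eps : R) (i : axis) f : R * R -> 'rV[R]_N :=
  fun u => eps^-1 *: (tau eps i f u - f u).

Definition delta_multi (eps : R) (a1 a2 : nat) f : R * R -> 'rV[R]_N :=
  iter a1 (delta eps axis1) (iter a2 (delta eps axis2) f).

(* The equation on every elementary lattice cell with all vertices in D. *)
Definition discrete_Mnet (eps : R) D (a : R * R -> R) g : Prop :=
  forall u, D u -> D (u + eps *: unit_vec axis1) -> D (u + eps *: unit_vec axis2) ->
    D (u + eps *: unit_vec axis1 + eps *: unit_vec axis2) ->
    tau eps axis1 (tau eps axis2 g) u + g u =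
    a u *: (tau eps axis1 g u + tau eps axis2 g u).

Definition canonical_discrete_Mnet (eps : R) D c1 c2 q g : Prop :=
  discrete_Mnet eps D (fun u => 1 + 2^-1 * eps ^+ 2 * q u) g /\
  axis_data D c1 c2 g.

(* The quotient delta^(a1,a2) at u involves the lattice points u + eps (k, l)
   with k <= a1 and l <= a2; they all lie in the square iff the two extreme
   ones do. *)
Definition converges_Oeps_Coo (r : R) (fe : R -> R * R -> 'rV[R]_N) f : Prop :=
  forall a1 a2 : nat, exists c : R, exists2 eps0 : R, 0 < eps0 &
    forall eps : R, 0 < eps < eps0 ->
    forall u, lattice_square eps r u ->
      lattice_square eps r (u + eps *: (a1%:R, a2%:R)) ->
      `|delta_multi eps a1 a2 (fe eps \- f) u| <= c * eps.

End MoutardNets.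

(* Main.v *)
Require Import Defs.
From mathcomp Require Import all_boot all_order all_algebra.
From mathcomp Require Import all_classical all_reals all_analysis.
From mathcomp Require Import ring lra.
Import Order.TTheory GRing.Theory Num.Theory.
Import numFieldNormedType.Exports.
Local Open Scope classical_set_scope.
Local Open Scope ring_scope.

Set Implicit Arguments.
Unset Strict Implicit.

(* Integrating twice turns the Goursat problem for the Moutard equation into
   f = g + A1 A2 (q f), where A_i is the antiderivative in the i-th variable
   vanishing on the other axis; a Picard iteration solves it on the whole plane,
   coordinate by coordinate, and the equation itself bootstraps f from C^n to
   C^(n+1).  Uniqueness on a small square is the contraction property, by two
   applications of the mean value theorem.

   For convergence put X = (f^eps - f) / eps on the lattice quadrant.  Then
   delta_1 delta_2 X = q/2 (tau_1 X + tau_2 X) + sigma, where sigma is the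
   consistency error of f divided by eps and has all its difference quotients
   bounded uniformly in eps.  A discrete Gronwall estimate bounds X.  If the
   quotients of X up to order s are bounded, so are those of delta_1 delta_2 X;
   since X vanishes on the axes, one summation bounds those of delta_1 X and of
   delta_2 X up to order s, hence those of X up to order s + 1. *)

(** * Increment estimates and antiderivatives in one real variable *)

Section OneVariable.
Context {R : realType}.
Implicit Types (f g df dg phi : R -> R) (a b x B : R).

(** Both [g - f] and [g + f] have a nonnegative derivative, so both are nondecreasing by the mean
    value theorem. *)
Lemma ler_increment f df g dg a b : a <= b ->
  (forall t, a <= t <= b -> is_derive t 1 f (df t)) ->
  (forall t, a <= t <= b -> is_derive t 1 g (dg t)) ->
  (forall t, a <= t <= b -> `|df t| <= dg t) ->
  `|f b - f a| <= g b - g a.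
Proof.
move=> ab fd gd dfg.
have key (h dh : R -> R) : (forall t, a <= t <= b -> is_derive t 1 h (dh t)) ->
    (forall t, a <= t <= b -> 0 <= dh t) -> h a <= h b.
  move=> hd dh0.
  have sub (t : R) : t \in `]a, b[ -> a <= t <= b.
    by rewrite in_itv/= => /andP[/ltW -> /ltW ->].
  have hc : {within `[a, b], continuous h}.
    apply: derivable_within_continuous => t; rewrite in_itv/= => tab.
    by have [] := hd _ tab.
  have [c cab hE] := MVT_segment ab (fun t tab => hd t (sub t tab)) hc.
  by rewrite -subr_ge0 hE mulr_ge0 ?subr_ge0// dh0.
have h1 : (g - f) a <= (g - f) b.
  apply: (key _ (fun t => dg t - df t)) => t tab.
    by have ? := fd _ tab; have ? := gd _ tab; exact: is_deriveB.
  by have := dfg _ tab; rewrite ler_norml subr_ge0 => /andP[].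
have h2 : (g + f) a <= (g + f) b.
  apply: (key _ (fun t => dg t + df t)) => t tab.
    by have ? := fd _ tab; have ? := gd _ tab; exact: is_deriveD.
  by have := dfg _ tab; rewrite ler_norml => /andP[]; lra.
rewrite ler_norml; move: h1 h2.
rewrite -![(_ - _) _]/(_ _ - _ _) -![(_ + _) _]/(_ _ + _ _); lra.
Qed.

Lemma ler_increment_cst f df a b B : a <= b ->
  (forall t, a <= t <= b -> is_derive t 1 f (df t)) ->
  (forall t, a <= t <= b -> `|df t| <= B) ->
  `|f b - f a| <= B * (b - a).
Proof.
move=> ab fd dfB; rewrite mulrBr.
apply: (@ler_increment _ df (fun t => B * t) (fun=> B)) => // t tab.
have := @is_deriveZ _ _ _ id B t 1 1; rewrite /GRing.scale/= mulr1; apply.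
Qed.

(** The difference [f - g] has derivative zero. The minimum and maximum let the endpoints come in
    either order. *)
Lemma eq_increment f g df a b :
  (forall t, Num.min a b <= t <= Num.max a b -> is_derive t 1 f (df t)) ->
  (forall t, Num.min a b <= t <= Num.max a b -> is_derive t 1 g (df t)) ->
  f b - f a = g b - g a.
Proof.
wlog ab : a b / a <= b => [hw|].
  case/orP: (le_total a b) => [|ba]; first exact: hw.
  by move=> hf hg; have := hw b a ba; rewrite minC maxC => /(_ hf hg); lra.
rewrite min_l// max_r// => fd gd.
have : `|(f - g) b - (f - g) a| <= 0 * (b - a).
  apply: (@ler_increment_cst _ (fun t => df t - df t)) => // t tab.
    by have ? := fd _ tab; have ? := gd _ tab; exact: is_deriveB.
  by rewrite subrr normr0.
rewrite mul0r normr_le0 -![(_ - _) _]/(_ _ - _ _) => /eqP; lra.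
Qed.

(** The fundamental theorem of calculus for the integral from [a] applies only to the right of [a],
    so no single base point serves the whole line. By [indep], increments of these integrals do not
    depend on the base point, which may therefore move with [x]. *)
Lemma antiderivative_ex phi : continuous phi ->
  exists2 f, f 0 = 0 & forall x, is_derive x 1 f (phi x).
Proof.
move=> cphi.
pose I a x := (\int[lebesgue_measure]_(t in [set` `[a, x]]) phi t)%R.
have dI a x : a < x -> is_derive x 1 (I a) (phi x).
  move=> ax.
  have int : lebesgue_measure.-integrable `[a, x + 1] (EFin \o phi).
    apply: continuous_compact_integrable; first exact: segment_compact.
    exact: continuous_subspaceT.
  have [|d1 d2] := continuous_FTC1_closed _ int ax (cphi x).
    by rewrite ltrDl.
  by split; [exact: d1|rewrite -derive1E; exact: d2].
have indep a b x : a < Num.min 0 x -> b < Num.min 0 x ->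
    I a x - I a 0 = I b x - I b 0.
  move=> ax bx; apply: (@eq_increment _ _ phi) => t /andP[t1 _].
    by apply: dI; exact: lt_le_trans t1.
  by apply: dI; exact: lt_le_trans t1.
(* The base point lies to the left of both 0 and [x]. Near a given [x] it can be exchanged for the
   fixed base point of [dIx], where the derivative is known. *)
exists (fun x => I (- `|x| - 1) x - I (- `|x| - 1) 0).
  by rewrite subrr.
move=> x.
have lt0 (y c : R) : `|y| < c -> - c < Num.min 0 y.
  move=> yc; rewrite lt_min oppr_lt0 (le_lt_trans _ yc)//=.
  by move: yc; rewrite ltr_norml => /andP[].
have dIx : is_derive x 1 (fun y => I (- `|x| - 2) y - I (- `|x| - 2) 0) (phi x).
  have := lt0 x (`|x| + 2); rewrite ltrDl ltr0n opprD => /(_ isT).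
  rewrite lt_min => /andP[_ /dI d1].
  by rewrite -[phi x]subr0; apply: is_deriveB.
apply: near_eq_is_derive dIx.
near=> y.
have xy : `|y| < `|x| + 1.
  have : `|x - y| < 1 by near: y; exact: (nbhsx_ballx x 1).
  by have := ler_normB x (x - y); rewrite subKr; lra.
apply: indep; rewrite -opprD; apply: lt0; [lra|].
by rewrite ltrDl.
Unshelve. all: by end_near. Qed.

End OneVariable.

(** * Coordinate lines in the plane and directional derivatives *)

Section PlaneCalculus.
Context {R : realType}.
Implicit Types (i j : axis) (u v : R * R) (t : R).

Definition crd i u : R := if i is axis1 then u.1 else u.2.
Definition upd i u t : R * R := if i is axis1 then (t, u.2) else (u.1, t).
Definition other i : axis := if i is axis1 then axis2 else axis1.

Lemma crd_upd i u t : crd i (upd i u t) = t. Proof. by case: i. Qed.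
Lemma upd_crd i u : upd i u (crd i u) = u. Proof. by case: i; case: u. Qed.
Lemma upd_upd i u t s : upd i (upd i u t) s = upd i u s.
Proof. by case: i. Qed.
Lemma crd_other_upd i u t : crd (other i) (upd i u t) = crd (other i) u.
Proof. by case: i. Qed.
Lemma upd_other i u t s :
  upd i (upd (other i) u t) s = upd (other i) (upd i u s) t.
Proof. by case: i. Qed.
Lemma otherK i : other (other i) = i. Proof. by case: i. Qed.
Lemma shift_unit_vec i u (h : R) : h *: unit_vec i + u = upd i u (h + crd i u).
Proof.
by case: i; apply: injective_projections; rewrite /= ?[_ *: 1]mulr1 ?[_ *: 0]mulr0 ?add0r.
Qed.

Lemma continuous_crd i : continuous (crd i).
Proof. by case: i => -[x y]; [exact: cvg_fst|exact: cvg_snd]. Qed.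

Lemma continuous_upd i u : continuous (upd i u).
Proof.
case: i => t.
  exact: (cvg_pair (F := nbhs t) (f := id) (g := cst u.2) cvg_id (cvg_cst _)).
exact: (cvg_pair (F := nbhs t) (f := cst u.1) (g := id) (cvg_cst _) cvg_id).
Qed.

(** The two difference quotients are the same function of the increment. This reduces partial
    derivatives to the calculus of one variable. *)
Lemma is_derive_line (W : normedModType R) (F : R * R -> W) i u (d : W) :
  is_derive u (unit_vec i) F d <->
  is_derive (crd i u) 1 (fun t => F (upd i u t)) d.
Proof.
have E : (fun h : R => h^-1 *: ((F \o shift u) (h *: unit_vec i) - F u)) =
    (fun h : R => h^-1 *: (((fun t => F (upd i u t)) \o shift (crd i u)) (h *: 1)
                     - F (upd i u (crd i u)))).
  apply/funext => h /=; rewrite upd_crd shift_unit_vec.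
  by rewrite [_%:A]mulr1.
by split=> -[d1 d2]; split; move: d1 d2; rewrite /derivable /derive E.
Qed.

End PlaneCalculus.

(** * Antiderivatives along one coordinate: continuity and differentiation *)

Section Antiderivatives.
Context {R : realType}.
Implicit Types (i : axis) (u v : R * R) (t L e : R) (h k : R * R -> R).

Lemma continuous_line h i u : continuous h -> continuous (fun t => h (upd i u t)).
Proof.
by move=> hc t; apply: (@continuous_comp _ _ _ (upd i u) h);
  [exact: continuous_upd|exact: hc].
Qed.

Lemma near_dist_lt (T : topologicalType) (f : T -> R) (x : T) e :
  {for x, continuous f} -> 0 < e -> \forall y \near x, `|f x - f y| < e.
Proof. by move=> fx e0; apply: (cvgr_dist_lt _ _ fx). Qed.

(** A tube argument: continuity gives a product neighbourhood at each [t], and compactness of the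
    segment [[- L, L]] makes one neighbourhood of [u] serve all [t]. *)
Lemma line_uniform h i u L e : continuous h -> 0 < e ->
  \forall v \near u, forall t, `|t| <= L ->
    `|h (upd i v t) - h (upd i u t)| < e.
Proof.
move=> hc e0.
have /compact_near_coveringP cov := @segment_compact R (- L) L.
have key : \forall v \near u, `[- L, L]%classic `<=`
    (fun t => `|h (upd i v t) - h (upd i u t)| < e).
  apply: (cov _ (nbhs u)
    (fun v t => `|h (upd i v t) - h (upd i u t)| < e)) => t _.
  have /cvgrPdist_lt /(_ (e / 2)) := hc (upd i u t).
  rewrite divr_gt0// => /(_ isT) /nbhs_ballP [d /= d0 dP].
  exists (ball t d, ball u d) => /=; first by split; exact: nbhsx_ballx.
  move=> [s v] /= [ts uv].
  have h1 : `|h (upd i u t) - h (upd i v s)| < e / 2.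
    by apply: dP; case: i uv => -[uv1 uv2]; split.
  have h2 : `|h (upd i u t) - h (upd i u s)| < e / 2.
    by apply: dP; case: i {h1} => /=; split => //=; exact: ballxx.
  have := ler_distD (h (upd i u t)) (h (upd i v s)) (h (upd i u s)).
  rewrite (distrC (h (upd i v s)) (h (upd i u t))); lra.
near=> v => t tL.
have kv : `[- L, L]%classic `<=` (fun t => `|h (upd i v t) - h (upd i u t)| < e).
  by near: v.
apply: kv => /=.
by rewrite in_itv/= -ler_norml.
Unshelve. all: by end_near. Qed.

(* The antiderivative vanishing at 0; constantly 0 if phi has none. *)
Definition prim (phi : R -> R) : R -> R :=
  xget (fun=> 0) [set f | f 0 = 0 /\ forall x : R, is_derive x 1 f (phi x)].

Lemma primP (phi : R -> R) : continuous phi ->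
  prim phi 0 = 0 /\ forall x : R, is_derive x 1 (prim phi) (phi x).
Proof.
by move=> /antiderivative_ex[f f0 fd]; rewrite /prim; case: xgetP => [//|/(_ f)[]].
Qed.

(** The bound is evaluated at the absolute value of [t], so that one statement covers both signs of
    [x]; a negative [x] is handled by reflecting [f]. *)
Lemma ler_norm_increment0 (f df G g : R -> R) (x : R) : f 0 = 0 ->
  (forall t, is_derive t 1 f (df t)) ->
  (forall t, is_derive t 1 G (g t)) ->
  (forall t, `|t| <= `|x| -> `|df t| <= g `|t|) ->
  `|f x| <= G `|x| - G 0.
Proof.
move=> f0 fd Gd dfg.
have [x0|x0] := leP 0 x.
  rewrite -[f x]subr0 -{1}f0; rewrite (ger0_norm x0) in dfg *.
  apply: (@ler_increment _ f df G g) => // t /andP[t0 tx].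
  by rewrite -{2}(ger0_norm t0) dfg// ger0_norm.
have -> : f x = (f \o -%R) (- x) - (f \o -%R) 0.
  by rewrite /= opprK oppr0 f0 subr0.
rewrite (ltr0_norm x0) in dfg *.
apply: (@ler_increment _ (f \o -%R) (fun t => df (- t) * -1) G g) => //.
- by rewrite oppr_ge0 ltW.
- move=> t /andP[t0 tx]; rewrite mulrN1 normrN.
  by rewrite -{2}(ger0_norm t0) -(normrN t) dfg// normrN ger0_norm.
Qed.

Lemma prim_dist (phi psi G g : R -> R) (x : R) :
  continuous phi -> continuous psi ->
  (forall t, is_derive t 1 G (g t)) ->
  (forall t, `|t| <= `|x| -> `|phi t - psi t| <= g `|t|) ->
  `|prim phi x - prim psi x| <= G `|x| - G 0.
Proof.
move=> hc kc Gg hk.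
have [h0 hd] := primP hc; have [k0 kd] := primP kc.
apply: (@ler_norm_increment0 (prim phi - prim psi)
  (fun t => phi t - psi t) G g) => //.
by rewrite -[LHS]/(prim _ 0 - prim _ 0) h0 k0 subrr.
Qed.

Lemma is_derive_lin (B t : R) : is_derive t 1 (fun t => B * t) B.
Proof.
by have := @is_deriveZ _ _ _ id B t 1 1; rewrite /GRing.scale/= mulr1; apply.
Qed.

Lemma prim_dist_cst (phi psi : R -> R) (x B : R) :
  continuous phi -> continuous psi ->
  (forall t, `|t| <= `|x| -> `|phi t - psi t| <= B) ->
  `|prim phi x - prim psi x| <= B * `|x|.
Proof.
move=> hc kc hk.
have := @prim_dist phi psi (fun t => B * t) (fun=> B) x hc kc.
by rewrite mulr0 subr0; apply => // t; exact: is_derive_lin.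
Qed.

Lemma prim_eq0 (phi : R -> R) (x : R) :
  continuous phi -> (forall t, phi t = 0) -> prim phi x = 0.
Proof.
move=> phic phi0; have [h0 hd] := primP phic.
have := @ler_norm_increment0 (prim phi) phi (fun t => 0 * t) (fun=> 0) x h0 hd.
rewrite !mul0r subrr normr_le0 => H; apply/eqP/H => t.
  exact: is_derive_lin.
by rewrite phi0 normr0.
Qed.

Definition antider i h : R * R -> R :=
  fun u => prim (fun t => h (upd i u t)) (crd i u).

Lemma antider_axis i h u : continuous h -> crd i u = 0 -> antider i h u = 0.
Proof.
move=> hc u0; rewrite /antider u0.
by have [] := primP (continuous_line (i := i) (u := u) hc).
Qed.

Lemma is_derive_antider i h u : continuous h ->
  is_derive u (unit_vec i) (antider i h) (h u).
Proof.
move=> hc; apply/is_derive_line.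
rewrite (_ : (fun t => _) = prim (fun t => h (upd i u t))).
  have [_ /(_ (crd i u))] := primP (continuous_line (i := i) (u := u) hc).
  by rewrite upd_crd.
apply/funext => t; rewrite /antider crd_upd; congr (prim _ _).
by apply/funext => s; rewrite upd_upd.
Qed.

(** The change from [u] to [v] is split in two: first the endpoint moves with the integrand kept on
    the line through [u], then the integrand changes, uniformly along the segment by
    [line_uniform]. *)
Lemma continuous_antider i h : continuous h -> continuous (antider i h).
Proof.
move=> hc u; apply/cvgrPdist_lt => e e0.
have [_ pd] := primP (continuous_line (i := i) (u := u) hc).
pose L := `|crd i u| + 1.
have L0 : 0 < L by rewrite ltr_wpDl.
have pc : {for crd i u, continuous (prim (fun t => h (upd i u t)))}.
  apply: differentiable_continuous; apply/derivable1_diffP.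
  by have [] := pd (crd i u).
near=> v.
have vL : `|crd i v| < L.
  have : `|crd i u - crd i v| < 1.
    by near: v; apply: (@near_dist_lt _ (crd i)) => //; exact: continuous_crd.
  by rewrite /L; have := ler_normB (crd i u) (crd i u - crd i v);
    rewrite subKr; lra.
have a1 : `|prim (fun t => h (upd i u t)) (crd i u) -
            prim (fun t => h (upd i u t)) (crd i v)| < e / 2.
  near: v; apply: (@near_dist_lt _ (prim (fun t => h (upd i u t)) \o crd i)).
    by apply: (@continuous_comp _ _ _ (crd i)); [exact: continuous_crd|exact: pc].
  by rewrite divr_gt0.
have a2 : `|antider i h v - prim (fun t => h (upd i u t)) (crd i v)| <= e / 4.
  apply: (@le_trans _ _ (e / 4 / L * `|crd i v|)).
    apply: prim_dist_cst => [||t tv]; [exact: continuous_line..|].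
    have tL : `|t| <= L by apply/(le_trans tv)/ltW.
    apply/ltW; move: t {tv} tL; near: v.
    by apply: line_uniform => //; rewrite !divr_gt0.
  by rewrite -mulrA ger_pMr ?divr_gt0// mulrC ler_pdivrMr// mul1r ltW.
have := ler_distD (prim (fun t => h (upd i u t)) (crd i v))
  (prim (fun t => h (upd i u t)) (crd i u)) (antider i h v).
rewrite (distrC (prim _ (crd i v)) (antider i h v)) -/(antider i h u); lra.
Unshelve. all: by end_near. Qed.

Lemma is_derive_ray h k i u (t : R) :
  (forall v, is_derive v (unit_vec i) h (k v)) ->
  is_derive t 1 (fun t => h (upd i u (crd i u + t))) (k (upd i u (crd i u + t))).
Proof.
move=> hk.
have d2 : is_derive t 1 (fun t => crd i u + t) 1.
  by rewrite -[X in is_derive _ _ _ X]add0r; apply: is_deriveD.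
have d3 : is_derive (crd i u + t) 1 (fun t => h (upd i u t))
    (k (upd i u (crd i u + t))).
  have := (is_derive_line h i (upd i u (crd i u + t)) _).1 (hk _).
  by rewrite crd_upd (_ : (fun r => _) = (fun r => h (upd i u r)))//;
    apply/funext => r; rewrite upd_upd.
by have := @is_derive1_comp _ _ _ _ _ _ d3 d2; rewrite mulr1.
Qed.

Lemma ray_increment h k i u (s B : R) :
  (forall v, is_derive v (unit_vec i) h (k v)) ->
  (forall t, `|t| <= `|s| -> `|k (upd i u (crd i u + t))| <= B) ->
  `|h (upd i u (crd i u + s)) - h u| <= B * `|s|.
Proof.
move=> hk kB.
have := @ler_norm_increment0 (fun t => h (upd i u (crd i u + t)) - h u)
  (fun t => k (upd i u (crd i u + t))) (fun t => B * t) (fun=> B) s.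
rewrite mulr0 subr0; apply => // [|t|t].
- by rewrite addr0 upd_crd subrr.
- have := is_deriveB (is_derive_ray u t hk) (is_derive_cst (h u) t (1 : R)).
  by rewrite subr0.
- exact: is_derive_lin.
Qed.

(** The linear part is subtracted before the increment estimate is applied, so the remainder is
    governed by the oscillation of [k] along the segment. *)
Lemma taylor1 h k i u (s B : R) :
  (forall v, is_derive v (unit_vec i) h (k v)) ->
  (forall t, `|t| <= `|s| -> `|k (upd i u (crd i u + t)) - k u| <= B) ->
  `|h (upd i u (crd i u + s)) - h u - s * k u| <= B * `|s|.
Proof.
move=> hk kB.
have := @ler_norm_increment0
  (fun t => h (upd i u (crd i u + t)) - h u - k u * t)
  (fun t => k (upd i u (crd i u + t)) - k u) (fun t => B * t) (fun=> B) s.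
rewrite [B * 0]mulr0 subr0 (mulrC s); apply => // [|t|t].
- by rewrite addr0 mulr0 subr0 upd_crd subrr.
- have := is_deriveB (is_deriveB (is_derive_ray u t hk)
    (is_derive_cst (h u) t (1 : R))) (is_derive_lin (k u) t).
  by rewrite subr0.
- exact: is_derive_lin.
Qed.

Lemma ray_near i u (P : R * R -> Prop) : (\forall v \near u, P v) ->
  exists2 d : R, 0 < d & forall s, `|s| < d -> P (upd i u (crd i u + s)).
Proof.
move=> /nbhs_ballP [d /= d0 dP]; exists d => // s sd; apply: dP.
have h0 : `|crd i u - (crd i u + s)| < d by rewrite opprD addrA subrr sub0r normrN.
by case: i h0 => h0; split => //=; exact: ballxx.
Qed.

(** Differentiation under the integral sign. The error of the difference quotient is itself an
    antiderivative, with integrand the Taylor error of [h] divided by [s]; [taylor1] and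
    [line_uniform] make that integrand at most [e / L], and the segment of integration is shorter
    than [L]. *)
Lemma is_derive_antider_other i h k u : continuous h -> continuous k ->
  (forall v, is_derive v (unit_vec (other i)) h (k v)) ->
  is_derive u (unit_vec (other i)) (antider i h) (antider i k u).
Proof.
move=> hc kc hk.
have lim : (fun s : R => s^-1 *: ((antider i h \o shift u) (s *: unit_vec (other i))
    - antider i h u)) @ 0^' --> antider i k u.
  apply/cvgrPdist_le => e e0.
  pose L := `|crd i u| + 1.
  have L0 : 0 < L by rewrite ltr_wpDl.
  have e1 : 0 < e / L by rewrite divr_gt0.
  have [d d0 dP] := ray_near (other i) (line_uniform i u L kc e1).
  near=> s.
  have s0 : s != 0 by near: s; exact: nbhs_dnbhs_neq.
  have sd : `|s| < d.
    by near: s; exact: dnbhs0_lt.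
  rewrite /= shift_unit_vec [s + _]addrC.
  set j := other i in hk dP *; set w := upd j u (crd j u + s).
  have crdw : crd i w = crd i u by rewrite /w /j -{1}(otherK i) crd_other_upd otherK.
  pose H v t := h (upd i v t); pose K t := k (upd i u t).
  have [w0 wd] := primP (continuous_line (i := i) (u := w) hc).
  have [u0 ud] := primP (continuous_line (i := i) (u := u) hc).
  have [k0 kd] := primP (continuous_line (i := i) (u := u) kc).
  rewrite -normrN opprB.
  have := @ler_norm_increment0
    (fun x => s^-1 * (prim (H w) x - prim (H u) x) - prim K x)
    (fun t => s^-1 * (H w t - H u t) - K t) (fun t => e / L * t) (fun=> e / L)
    (crd i u).
  rewrite mulr0 subr0 /antider crdw => bound.
  apply: le_trans (bound _ _ _ _) _.
  - by rewrite w0 u0 k0 !subr0 mulr0.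
  - move=> t; have ? := wd t; have ? := ud t; have ? := kd t.
    exact: (is_deriveB (is_deriveZ s^-1 (is_deriveB (wd t) (ud t))) (kd t)).
  - by move=> t; exact: is_derive_lin.
  - move=> t tu.
    have tL : `|t| <= L by rewrite (le_trans tu)// lerDl.
    have crdj : crd j (upd i u t) = crd j u by exact: crd_other_upd.
    have := @taylor1 h k j (upd i u t) s (e / L) hk.
    rewrite crdj -upd_other -/w => tay.
    have -> : s^-1 * (H w t - H u t) - K t = s^-1 * (H w t - H u t - s * K t).
      by rewrite [RHS]mulrBr mulKf.
    rewrite normrM normfV mulrC ler_pdivrMr ?normr_gt0//; apply: tay => r rs.
    by rewrite -upd_other; apply/ltW/dP => //; exact: le_lt_trans sd.
  - by rewrite mulrAC ler_pdivrMr// ler_wpM2l// ?ltW// /L ltrDl.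
split; first by apply/cvg_ex; exists (antider i k u).
exact: cvg_lim.
Unshelve. all: by end_near.
Qed.

End Antiderivatives.

(** * Functions of class C^n on the plane *)

Section Regularity.
Context {R : realType}.
Implicit Types (i : axis) (u : R * R) (n : nat) (F G : R * R -> R).

Fixpoint Cn n F : Prop :=
  continuous F /\
  if n is m.+1 then
    forall i, (forall u, derivable F u (unit_vec i)) /\ Cn m (partial i F)
  else True.

Lemma Cn_continuous n F : Cn n F -> continuous F.
Proof. by case: n => [|n] []. Qed.

(** Introduction rule for inductions on the order: candidates for the partial derivatives are named
    explicitly and identified with [partial] once and for all. *)
Lemma CnS n F (D : axis -> R * R -> R) : continuous F ->
  (forall i u, is_derive u (unit_vec i) F (D i u)) ->
  (forall i, Cn n (D i)) -> Cn n.+1 F.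
Proof.
move=> Fc FD Dn; split=> // i; split=> [u|]; first by have [] := FD i u.
by rewrite (_ : partial i F = D i)//; apply/funext => u; have [] := FD i u.
Qed.

Lemma Cn_is_derive n F i u : Cn n.+1 F ->
  is_derive u (unit_vec i) F (partial i F u).
Proof. by move=> [_ /(_ i)[/(_ u) ? _]]; exact: derivableP. Qed.

Lemma Cn_partial n F i : Cn n.+1 F -> Cn n (partial i F).
Proof. by move=> [_ /(_ i)[]]. Qed.

Lemma CnW n F : Cn n.+1 F -> Cn n F.
Proof.
elim: n F => [|n IH] F FC; first by split=> //; exact: Cn_continuous FC.
split=> [|i]; first exact: Cn_continuous FC.
by have [_ /(_ i)[dF /IH]] := FC.
Qed.

Lemma Cn_cst n (a : R) : Cn n (cst a).
Proof.
elim: n a => [|n IH] a; first by split=> // u; exact: cst_continuous.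
by apply: (@CnS _ _ (fun _ => cst 0)) => [u|i]; [exact: cst_continuous|exact: IH].
Qed.

Lemma CnD n F G : Cn n F -> Cn n G -> Cn n (F \+ G).
Proof.
elim: n F G => [|n IH] F G FC GC.
  by split=> // u; apply: continuousD; [exact: FC.1|exact: GC.1].
apply: (@CnS _ _ (fun i => partial i F \+ partial i G)) => [u|i u|i].
- by apply: continuousD; [exact: FC.1|exact: GC.1].
- have := Cn_is_derive i u FC; have := Cn_is_derive i u GC.
  by move=> ? ?; exact: is_deriveD.
- by apply: IH; exact: Cn_partial.
Qed.

Lemma CnM n F G : Cn n F -> Cn n G -> Cn n (F \* G).
Proof.
elim: n F G => [|n IH] F G FC GC.
  by split=> // u; apply: continuousM; [exact: FC.1|exact: GC.1].
apply: (@CnS _ _ (fun i => (F \* partial i G) \+ (G \* partial i F))) => [u|i u|i].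
- by apply: continuousM; [exact: FC.1|exact: GC.1].
- have := Cn_is_derive i u FC; have := Cn_is_derive i u GC.
  by move=> ? ?; exact: is_deriveM.
- by apply: CnD; apply: IH; first [exact: Cn_partial|exact: CnW].
Qed.

(** [Cn] peels off the innermost derivative of a word while [partials] adds outer ones; appending a
    letter at the end of the word reconciles the two recursions. *)
Lemma smooth_onT_Cn F : smooth_on setT F <-> forall n, Cn n F.
Proof.
split=> [Fs n|FC w u _].
  elim: n F Fs => [|n IH] F Fs.
    by split=> // u; have [] := Fs [::] u I.
  split=> [u|i]; first by have [] := Fs [::] u I.
  split=> [u|]; first by have [/(_ i)] := Fs [::] u I.
  apply: IH => w u _; have := Fs (rcons w i) u I.
  by rewrite /partials foldr_rcons.
have : forall n, Cn n (partials w F).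
  by elim: w => [//|i w IH n] /=; exact/Cn_partial/IH.
move=> FwC; split=> [i|]; first by have [] := Cn_is_derive i u (FwC 1%N).
have FwC0 : continuous (partials w F) := Cn_continuous (FwC 0%N).
exact: FwC0.
Qed.

Lemma axis_neq i j : j <> i -> j = other i.
Proof. by case: i; case: j. Qed.

(** In direction [i] differentiation gives back [F]; in the other direction it passes under the
    integral, where the induction hypothesis applies to the partial derivative of [F]. *)
Lemma Cn_antider n i F : Cn n F -> Cn n (antider i F).
Proof.
elim: n F => [|n IH] F FC.
  by split=> //; exact: continuous_antider FC.1.
have Fc := Cn_continuous FC.
pose D j := if pselect (j = i) then F else antider i (partial j F).
apply: (@CnS _ _ D) => [|j u|j]; first exact: continuous_antider.
  rewrite /D; case: pselect => ji /=; first by rewrite ji; exact: is_derive_antider.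
  rewrite (axis_neq ji).
  apply: is_derive_antider_other => //; first exact: Cn_continuous (Cn_partial _ FC).
  by move=> v; exact: Cn_is_derive FC.
rewrite /D; case: pselect => ? /=; first exact: CnW.
exact/IH/Cn_partial.
Qed.

Lemma is_derive_curve (c : R -> R) i u : smooth_curve c ->
  is_derive u (unit_vec i) (c \o crd i) (derive1 c (crd i u)).
Proof.
move=> cs; apply/is_derive_line.
rewrite (_ : (fun t => _) = c); last by apply/funext => t /=; rewrite crd_upd.
by rewrite /= derive1E; apply/derivableP; have := cs 0%N; apply.
Qed.

Lemma is_derive_curve_other (c : R -> R) i u :
  is_derive u (unit_vec (other i)) (c \o crd i) 0.
Proof.
apply/is_derive_line; rewrite (_ : (fun t => _) = cst (c (crd i u))).
  exact: is_derive_cst.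
by apply/funext => t /=; case: i.
Qed.

Lemma smooth_curve_derive1 (c : R -> R) : smooth_curve c -> smooth_curve (derive1 c).
Proof. by move=> cs m t; have := cs m.+1 t; rewrite /derive1n iterSr. Qed.

Lemma Cn_curve (c : R -> R) n i : smooth_curve c -> Cn n (c \o crd i).
Proof.
have cc d : smooth_curve d -> continuous d.
  move=> /(_ 0%N) dd t; apply: differentiable_continuous.
  exact/derivable1_diffP/dd.
have ccrd d : smooth_curve d -> continuous (d \o crd i).
  move=> /cc dc u; apply: continuous_comp; last exact: dc.
  exact: continuous_crd.
elim: n c => [|n IH] c cs; first by split=> //; exact: ccrd.
pose D j := if pselect (j = i) then derive1 c \o crd i else cst 0.
apply: (@CnS _ _ D) => [|j u|j]; first exact: ccrd.
  rewrite /D; case: pselect => ji /=; first by rewrite ji; exact: is_derive_curve.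
  by rewrite (axis_neq ji); exact: is_derive_curve_other.
rewrite /D; case: pselect => ? /=; last exact: Cn_cst.
exact/IH/smooth_curve_derive1.
Qed.

End Regularity.

(** * Global smooth solutions of the scalar Goursat problem *)

Section Goursat.
Context {R : realType}.
Implicit Types (i : axis) (u : R * R) (n : nat) (L : R).

Definition box L : set (R * R) := [set u | `|u.1| <= L /\ `|u.2| <= L].

Lemma box_upd L i u (t : R) : box L u -> `|t| <= `|crd i u| -> box L (upd i u t).
Proof. by case: i => -[u1 u2] /= tu; split=> //=; exact: le_trans tu _. Qed.

Lemma box_bounded (F : R * R -> R) L : continuous F ->
  exists2 B, 0 < B & forall u, box L u -> `|F u| <= B.
Proof.
move=> Fc; have cK : compact (`[- L, L]%classic `*` `[- L, L]%classic).
  by apply: compact_setX; exact: segment_compact.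
have /compact_bounded [M [_ MP]] :
    compact (F @` (`[- L, L]%classic `*` `[- L, L]%classic)).
  by apply: continuous_compact => //; exact: continuous_subspaceT.
exists (`|M| + 1) => [|u [u1 u2]]; first by rewrite ltr_wpDl.
apply: MP; first by rewrite (le_lt_trans (ler_norm M))// ltrDl.
by exists u => //; split; rewrite /= in_itv/= -ler_norml.
Qed.

Lemma geometric_lt (C e : R) : 0 < e -> exists n, C * 2^-1 ^+ n < e.
Proof.
move=> e0; have : (fun n => C * 2^-1 ^+ n) @ \oo --> C * 0.
  apply: cvgMr; apply: cvg_expr.
  by rewrite ger0_norm ?invr_ge0// invf_lt1// ltr1n.
rewrite mulr0 => /cvgrPdist_lt /(_ e e0) [n _ /(_ n)].
rewrite /= leqnn sub0r normrN => /(_ isT) nP; exists n.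
exact: le_lt_trans (ler_norm _) nP.
Qed.

(** The usual three-term estimate, on a box large enough to contain a neighbourhood of [u]. *)
Lemma continuous_uniform_limit (f : R * R -> R) (fn : nat -> R * R -> R) :
  (forall n, continuous (fn n)) ->
  (forall L, exists C, forall n u, box L u -> `|f u - fn n u| <= C * (2^-1) ^+ n) ->
  continuous f.
Proof.
move=> fnc fnf u; apply/cvgrPdist_lt => e e0.
pose L := Num.max `|u.1| `|u.2| + 1.
have [C CP] := fnf L.
have [n nP] := geometric_lt C (divr_gt0 e0 (ltr0n R 3)).
have nb i : \forall v \near u, `|crd i u - crd i v| < 1.
  by apply: (@near_dist_lt _ _ (crd i)) => //; exact: continuous_crd.
near=> v.
have a1 : `|fn n u - fn n v| < e / 3.
  by near: v; apply: (@near_dist_lt _ _ (fn n)); [exact: fnc|rewrite divr_gt0].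
have uL : box L u by split; rewrite /L; case: (leP `|u.1| `|u.2|); lra.
have vL : box L v.
  have b i : `|crd i u - crd i v| < 1.
    by case: i; near: v; exact: nb.
  have c i : `|crd i v| <= `|crd i u| + 1.
    have := b i; have := ler_normB (crd i u) (crd i u - crd i v).
    by rewrite subKr; lra.
  by have := c axis1; have := c axis2; split; rewrite /L;
    case: (leP `|u.1| `|u.2|); rewrite /= in c *; lra.
have := CP n u uL; have := CP n v vL.
have := ler_distD (fn n u) (f u) (f v).
have := ler_distD (fn n v) (fn n u) (f v).
rewrite (distrC (fn n v) (f v)); lra.
Unshelve. all: by end_near. Qed.

(** * Picard iteration for the integrated equation *)

Section Picard.
Variables (q g : R * R -> R).
Hypotheses (qc : continuous q) (gc : continuous g).

(** The double antiderivative vanishes on both axes, so [g] carries the boundary values of a fixed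
    point. *)
Definition picard (f : R * R -> R) : R * R -> R :=
  g \+ antider axis1 (antider axis2 (q \* f)).

Lemma continuous_picard f : continuous f -> continuous (picard f).
Proof.
move=> fc u; apply: continuousD; first exact: gc.
do 2 apply: continuous_antider; move=> v.
by apply: continuousM; [exact: qc|exact: fc].
Qed.

(* Weighting by [expR (l * `|x|)] makes the Picard map a contraction on the
   whole box: the outer integration gains a factor [1 / l]. *)
Lemma picard_contract L : 0 < L -> exists2 l, 0 < l & forall f h B,
  continuous f -> continuous h -> 0 <= B ->
  (forall u, box L u -> `|f u - h u| <= B * expR (l * `|u.1|)) ->
  forall u, box L u -> `|picard f u - picard h u| <= B / 2 * expR (l * `|u.1|).
Proof.
move=> L0; have [Q Q0 qQ] := box_bounded L qc.
(* The coefficient and the inner integration cost [Q * L], the outer integration gains [1 / l]; this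
   [l] makes the product 1/2. *)
exists (2 * Q * L) => [|f h B fc hc B0 fh u uL]; first by rewrite !mulr_gt0.
set l := 2 * Q * L.
have qfc k : continuous k -> continuous (q \* k).
  by move=> kc v; apply: continuousM; [exact: qc|exact: kc].
have -> : picard f u - picard h u =
  antider axis1 (antider axis2 (q \* f)) u - antider axis1 (antider axis2 (q \* h)) u.
  by rewrite /picard /=; ring.
have l0 : 0 < l by rewrite !mulr_gt0.
have := @prim_dist _ (fun t => antider axis2 (q \* f) (upd axis1 u t))
  (fun t => antider axis2 (q \* h) (upd axis1 u t))
  (fun t => B / 2 * expR (l * t)) (fun t => B * Q * L * expR (l * t)) u.1.
move=> H; apply: le_trans (H _ _ _ _) _ => {H}.
- by apply: continuous_line; apply: continuous_antider; exact: qfc.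
- by apply: continuous_line; apply: continuous_antider; exact: qfc.
- move=> t; have d1 := is_derive1_comp (is_derive_expR (l * t)) (is_derive_lin l t).
  have := is_deriveZ (B / 2) d1.
  rewrite (_ : _ *: _ = B * Q * L * expR (l * t)) //.
  have -> : B * Q * L = B / 2 * l by rewrite /l; field.
  by rewrite -[RHS]mulrA [in RHS](mulrC l).
- move=> t tu.
  have vL := @box_upd L axis1 u t uL tu.
  apply: le_trans (_ : Q * (B * expR (l * `|t|)) * L <= _); last first.
    by rewrite le_eqVlt; apply/orP; left; apply/eqP; ring.
  apply: le_trans (_ : Q * (B * expR (l * `|t|)) * `|u.2| <= _); last first.
    by rewrite ler_wpM2l ?mulr_ge0 ?expR_ge0 ?(ltW Q0)//; case: uL.
  apply: prim_dist_cst => [||s su].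
  + by apply: continuous_line; exact: qfc.
  + by apply: continuous_line; exact: qfc.
  + rewrite /= -mulrBr normrM ler_pM//.
      by apply: qQ; exact: (@box_upd L axis2 (t, u.2) s vL su).
    have := fh (t, s) (@box_upd L axis2 (t, u.2) s vL su).
    by [].
- by rewrite gerBl mulr_ge0 ?expR_ge0 ?divr_ge0.
Qed.

(** On every box the weighted contraction makes the iterates Cauchy at a geometric rate. Their
    pointwise limit is thus uniform on boxes and continuous, and one more use of the contraction
    shows that it is fixed. *)
Lemma picard_fixpoint : exists2 f, continuous f & f = picard f.
Proof.
pose fn n := iter n picard g.
have fnc n : continuous (fn n).
  by elim: n => [//|n IH]; exact: continuous_picard.
have cauchy L : exists2 C, 0 < C & forall n p u, box L u ->
    `|fn (n + p)%N u - fn n u| <= C * 2^-1 ^+ n.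
  wlog L0 : L / 0 < L => [hw|].
    have [|C C0 CP] := hw (`|L| + 1); first by rewrite ltr_wpDl.
    exists C => // n p u [u1 u2]; apply: CP.
    by have := ler_norm L; split; lra.
  have [l l0 contr] := picard_contract L0.
  have [|B B0 hB] := @box_bounded (fn 1%N \- fn 0%N) L.
    by move=> u; apply: continuousB; exact: fnc.
  have step n u : box L u ->
      `|fn n.+1 u - fn n u| <= B * 2^-1 ^+ n * expR (l * `|u.1|).
    elim: n u => [|n IH] u uL.
      rewrite expr0 mulr1 (le_trans (hB u uL))// ler_peMr// ?(ltW B0)//.
      by rewrite -expR0 ler_expR mulr_ge0 // ltW.
    rewrite exprSr mulrA; apply: (contr (fn n.+1) (fn n)) => //.
    by rewrite mulr_ge0 ?exprn_ge0 ?invr_ge0// ltW.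
  pose E := expR (l * L).
  have step' n u : box L u -> `|fn n.+1 u - fn n u| <= B * 2^-1 ^+ n * E.
    move=> uL; apply: le_trans (step n u uL) _.
    rewrite ler_wpM2l ?mulr_ge0 ?exprn_ge0 ?invr_ge0 ?(ltW B0)//.
    by rewrite ler_expR ler_wpM2l ?(ltW l0)//; case: uL.
  exists (2 * B * E) => [|n p u uL]; first by rewrite !mulr_gt0 ?expR_gt0.
  (* Keeping the subtracted tail of the geometric series lets the induction on [p] close. *)
  have : `|fn (n + p)%N u - fn n u| <= 2 * B * E * (2^-1 ^+ n - 2^-1 ^+ (n + p)).
    elim: p => [|p IH]; first by rewrite addn0 !subrr normr0 mulr0.
    rewrite addnS; apply: le_trans (ler_distD (fn (n + p)%N u) _ _) _.
    apply: le_trans (lerD (step' _ _ uL) IH) _.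
    by rewrite exprS; lra.
  move=> h; apply: le_trans h _; rewrite ler_wpM2l ?mulr_ge0 ?expR_ge0 ?(ltW B0)//.
  by rewrite gerBl exprn_ge0 ?invr_ge0.
have cv u : cvgn (fn ^~ u).
  have [C C0 CP] := cauchy (Num.max `|u.1| `|u.2|).
  have uL : box (Num.max `|u.1| `|u.2|) u.
    by split; rewrite le_max lexx ?orbT.
  apply: cauchy_cvg; apply/cauchy_exP => e e0.
  have [n nP] := geometric_lt C e0.
  exists (fn n u); exists n => // m /= nm.
  rewrite -ball_normE /= distrC -(subnKC nm).
  exact: le_lt_trans (CP n (m - n)%N u uL) nP.
pose f u := limn (fn ^~ u).
have flim L : exists2 C, 0 < C & forall n u, box L u ->
    `|f u - fn n u| <= C * 2^-1 ^+ n.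
  have [C C0 CP] := cauchy L; exists C => // n u uL.
  apply/ler_addgt0Pr => e e0.
  have /cvgrPdist_le /(_ e e0) [m _ /(_ (n + m)%N)] : fn ^~ u @ \oo --> f u := cv u.
  rewrite /= leq_addl => /(_ isT) h.
  apply: le_trans (ler_distD (fn (n + m)%N u) _ _) _.
  by rewrite addrC lerD// CP.
have fc : continuous f.
  apply: continuous_uniform_limit fnc _ => L; have [C _ CP] := flim L.
  by exists C.
exists f => //; apply/funext => u; apply/eqP; rewrite -subr_eq0 -normr_le0.
pose L := Num.max `|u.1| `|u.2| + 1.
have L0 : 0 < L by rewrite ltr_wpDl// le_max normr_ge0.
have uL : box L u.
  by split; rewrite (@le_trans _ _ (Num.max `|u.1| `|u.2|)) ?lerDl// le_max lexx ?orbT.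
have [C C0 CP] := flim L; have [l l0 contr] := picard_contract L0.
pose E := expR (l * `|u.1|).
apply/ler_addgt0Pr => e e0; rewrite add0r.
(* The term 1 accounts for the distance from [f] to the iterate [n.+1], the term [E] for the
   distance from that iterate to [picard f]. An unweighted bound is also a weighted one because the
   weight is at least 1. *)
have [n nP] := geometric_lt (C * (1 + E)) e0.
apply: le_trans (ltW nP).
apply: le_trans (ler_distD (fn n.+1 u) _ _) _.
have C2 : 0 <= C * 2^-1 ^+ n by rewrite mulr_ge0 ?exprn_ge0 ?invr_ge0 ?ltW.
have h1 : `|picard f u - picard (fn n) u| <= C * 2^-1 ^+ n / 2 * E.
  apply: contr => // v vL; apply: le_trans (CP n v vL) _.
  by rewrite ler_peMr// -expR0 ler_expR mulr_ge0// ltW.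
have h2 := CP n.+1 u uL.
rewrite distrC in h1.
have E0 : 0 <= E by exact: expR_ge0.
have CE := mulr_ge0 C2 E0; rewrite exprS in h2.
apply: le_trans (lerD h2 h1) _.
by rewrite mulrAC mulrDr mulr1; lra.
Qed.

End Picard.

(** The fixed-point equation expresses each first partial derivative of [f] by one of [g] and a
    single antiderivative of [q \* f], which is of class C^n as soon as [f] is. *)
Lemma Cn_picard_fixpoint (q g f : R * R -> R) :
  (forall n, Cn n q) -> (forall n, Cn n g) -> continuous f ->
  f = picard q g f -> forall n, Cn n f.
Proof.
move=> qC gC fc fE; elim=> [//|n IH].
have hC : Cn n (q \* f) by exact: CnM.
have hc := Cn_continuous hC.
pose D i := partial i g \+ antider (other i) (q \* f).
(* Direction 1 undoes the outer antiderivative; direction 2 passes under it and undoes the inner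
   one. *)
have dA i u : is_derive u (unit_vec i)
    (antider axis1 (antider axis2 (q \* f))) (antider (other i) (q \* f) u).
  case: i; first by apply: is_derive_antider; exact: continuous_antider.
  apply: (@is_derive_antider_other _ axis1) => //; first exact: continuous_antider.
  by move=> v; exact: is_derive_antider.
apply: (@CnS _ _ _ D) => // [i u|i].
  rewrite fE /picard; have := Cn_is_derive i u (gC 1%N); have := dA i u.
  by move=> ? ?; exact: is_deriveD.
by apply: CnD; [exact: Cn_partial|exact: Cn_antider].
Qed.

Theorem goursat (q : R * R -> R) (c1 c2 : R -> R) :
  smooth_on setT q -> smooth_curve c1 -> smooth_curve c2 -> c1 0 = c2 0 ->
  exists F : R * R -> R, [/\ smooth_on setT F,
    forall u, partial axis1 (partial axis2 F) u = q u * F u,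
    forall x, F (x, 0) = c1 x & forall y, F (0, y) = c2 y].
Proof.
move=> /smooth_onT_Cn qC c1s c2s c12.
(* This sum has mixed derivative zero and, since the curves meet at 0, takes the prescribed values
   on both axes. *)
pose g : R * R -> R := (c1 \o crd axis1) \+ (c2 \o crd axis2) \+ cst (- c1 0).
have gC n : Cn n g.
  by do ![apply: CnD]; [exact: Cn_curve|exact: Cn_curve|exact: Cn_cst].
have qc := Cn_continuous (qC 0%N); have gc := Cn_continuous (gC 0%N).
have [f fc fE] := picard_fixpoint qc gc.
have fC := Cn_picard_fixpoint qC gC fc fE.
have hc : continuous (q \* f) by exact: Cn_continuous (CnM (qC 0%N) (fC 0%N)).
pose h := antider axis1 (antider axis2 (q \* f)).
have fgh : f = g \+ h by [].
exists f; split=> [|u|x|y]; first exact/smooth_onT_Cn.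
- have dh v : is_derive v (unit_vec axis2) h (antider axis1 (q \* f) v).
    apply: (@is_derive_antider_other _ axis1) => //; first exact: continuous_antider.
    by move=> w; exact: is_derive_antider.
  have d2 : partial axis2 f = (derive1 c2 \o crd axis2) \+ antider axis1 (q \* f).
    apply/funext => v; rewrite {1}fgh.
    have := @is_derive_curve_other _ c1 axis1 v.
    have := is_derive_curve axis2 v c2s => dc2 dc1.
    have := is_deriveD (is_deriveD (is_deriveD dc1 dc2) (is_derive_cst (- c1 0) v _)) (dh v).
    by move=> /@derive_val; rewrite addr0 add0r.
  rewrite d2.
  have dc := @is_derive_curve_other _ (derive1 c2) axis2 u.
  have dA := is_derive_antider axis1 u hc.
  by have /@derive_val := is_deriveD dc dA; rewrite add0r.
- rewrite fgh /g /h /= [X in _ + X](_ : _ = 0); first by rewrite -c12; ring.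
  apply: prim_eq0 => [|t]; first by apply: continuous_line; exact: continuous_antider.
  exact: antider_axis.
- rewrite fgh /g /h /= antider_axis//; first by ring.
  exact: continuous_antider.
Qed.

End Goursat.

(** * Families of grid functions with uniformly bounded difference quotients *)

Section GridFamilies.
Context {R : realType}.
Implicit Types (i j : axis) (eps L : R) (m n s : nat).
Implicit Types (X Y q sigma : R -> nat -> nat -> R).

Definition gshift {T : Type} i (x : nat -> nat -> T) : nat -> nat -> T :=
  fun m n => if i is axis1 then x m.+1 n else x m n.+1.

(* Families X are indexed by the mesh eps; X eps m n stands for the value at the
   lattice point (eps m, eps n). *)
Definition gdiff i X : R -> nat -> nat -> R :=
  fun eps m n => eps^-1 * (gshift i (X eps) m n - X eps m n).

Definition gbounded X : Prop := forall L, exists2 C, 0 <= C &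
  forall eps m n, 0 < eps <= 1 -> eps * m%:R <= L -> eps * n%:R <= L ->
    `|X eps m n| <= C.

(* All difference quotients of X up to order s are bounded on each [0, L]^2,
   uniformly in the mesh eps <= 1. *)
Fixpoint gBn s X : Prop :=
  gbounded X /\ if s is k.+1 then forall i, gBn k (gdiff i X) else True.

(** The index names the coordinate that is zero: [gvanish axis1] concerns the points of
    [axis_line axis2]. This is the initial condition for summation in direction [i]. *)
Definition gvanish i X : Prop :=
  forall eps m, (if i is axis1 then X eps 0%N m else X eps m 0%N) = 0.

(** Boundedness inspects positive meshes only, and the discrete equation is available only for
    those. *)
Lemma gBn_ext s X Y : (forall eps, 0 < eps -> X eps = Y eps) ->
  gBn s X -> gBn s Y.
Proof.
have bext X' Y' : (forall eps, 0 < eps -> X' eps = Y' eps) ->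
    gbounded X' -> gbounded Y'.
  move=> XY Xb L; have [C C0 CP] := Xb L; exists C => // eps m n /andP[e0 e1] *.
  by rewrite -XY// CP// e0.
elim: s X Y => [|s IH] X Y XY [Xb Xs]; split; try exact: bext Xb; first by [].
move=> i; apply: IH (Xs i) => eps e0; by rewrite /gdiff XY.
Qed.

Lemma gBn_bounded s X : gBn s X -> gbounded X.
Proof. by case: s => [|s] []. Qed.

Lemma gBn_diff s X i : gBn s.+1 X -> gBn s (gdiff i X).
Proof. by move=> [_ /(_ i)]. Qed.

Lemma gBnW s X : gBn s.+1 X -> gBn s X.
Proof.
elim: s X => [|s IH] X [Xb Xs]; split => // i; exact/IH/Xs.
Qed.

Lemma gdiffC i j X : gdiff i (gdiff j X) = gdiff j (gdiff i X).
Proof.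
apply/funext => eps; apply/funext => m; apply/funext => n.
by case: i; case: j; rewrite /gdiff /=; ring.
Qed.

Lemma gboundedD X Y : gbounded X -> gbounded Y ->
  gbounded (fun eps m n => X eps m n + Y eps m n).
Proof.
move=> Xb Yb L; have [C C0 CP] := Xb L; have [D D0 DP] := Yb L.
exists (C + D) => [|*]; first exact: addr_ge0.
by rewrite (le_trans (ler_normD _ _))// lerD ?CP ?DP.
Qed.

Lemma gboundedM X Y : gbounded X -> gbounded Y ->
  gbounded (fun eps m n => X eps m n * Y eps m n).
Proof.
move=> Xb Yb L; have [C C0 CP] := Xb L; have [D D0 DP] := Yb L.
exists (C * D) => [|*]; first exact: mulr_ge0.
by rewrite normrM ler_pM ?CP ?DP.
Qed.

Lemma gbounded_shift i X : gbounded X -> gbounded (fun eps => gshift i (X eps)).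
Proof.
(* A shift leaves the square of side [L] by at most one mesh, which is at most 1. *)
move=> Xb L; have [C C0 CP] := Xb (L + 1).
exists C => // eps m n /andP[e0 e1] mL nL.
by case: i; apply: CP; rewrite ?e0 ?e1// -?natr1 ?mulrDr ?mulr1; lra.
Qed.

Lemma gBnD s X Y : gBn s X -> gBn s Y ->
  gBn s (fun eps m n => X eps m n + Y eps m n).
Proof.
elim: s X Y => [|s IH] X Y [Xb Xs] [Yb Ys]; split; try exact: gboundedD; first by [].
move=> i; apply: gBn_ext (IH _ _ (Xs i) (Ys i)) => eps _.
apply/funext => m; apply/funext => n.
by case: i; rewrite /gdiff /=; ring.
Qed.

Lemma gBn_shift s i X : gBn s X -> gBn s (fun eps => gshift i (X eps)).
Proof.
elim: s X => [|s IH] X [Xb Xs]; split; try exact: gbounded_shift; first by [].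
by move=> j; apply: gBn_ext (IH _ (Xs j)) => eps _; case: i {IH}; case: j {Xs}.
Qed.

(** By the discrete Leibniz rule the quotient of a product has a shift on one factor, hence the use
    of [gBn_shift]. *)
Lemma gBnM s X Y : gBn s X -> gBn s Y ->
  gBn s (fun eps m n => X eps m n * Y eps m n).
Proof.
elim: s X Y => [|s IH] X Y XB YB; split; try exact: gboundedM (gBn_bounded XB) (gBn_bounded YB).
  by [].
move=> i; apply: gBn_ext (gBnD (IH _ _ (gBn_diff i XB) (gBnW YB))
  (IH _ _ (gBn_shift i (gBnW XB)) (gBn_diff i YB))) => eps _.
apply/funext => m; apply/funext => n.
by case: i; rewrite /gdiff /=; ring.
Qed.

Lemma gBn_cst s (a : R) : gBn s (fun _ _ _ => a).
Proof.
elim: s a => [|s IH] a; (split; first by move=> L; exists `|a|); first by [].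
move=> i; apply: gBn_ext (IH 0) => eps _.
apply/funext => m; apply/funext => n.
by case: i {IH}; rewrite /gdiff /= subrr mulr0.
Qed.

Lemma ler_norm_telescope (y : nat -> R) eps C L : 0 < eps -> y 0%N = 0 ->
  (forall k, eps * k%:R <= L -> `|eps^-1 * (y k.+1 - y k)| <= C) ->
  forall k, eps * k%:R <= L -> `|y k| <= C * (eps * k%:R).
Proof.
move=> e0 y0 yC; elim=> [|k IH] kL; first by rewrite y0 normr0 !mulr0.
have kL' : eps * k%:R <= L.
  by apply: le_trans kL; rewrite ler_wpM2l ?(ltW e0)// ler_nat.
have -> : y k.+1 = y k + eps * (eps^-1 * (y k.+1 - y k)).
  by rewrite mulVKf ?gt_eqF//; ring.
have -> : C * (eps * k.+1%:R) = C * (eps * k%:R) + C * eps by rewrite -natr1; ring.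
rewrite (le_trans (ler_normD _ _))// lerD ?IH//.
by rewrite normrM gtr0_norm// mulrC ler_wpM2r ?(ltW e0)// yC.
Qed.

Lemma gbounded_integrate i Y : gvanish i Y -> gbounded (gdiff i Y) -> gbounded Y.
Proof.
move=> Y0 Db L; have [C C0 CP] := Db L.
exists (C * `|L|) => [|eps m n e01 mL nL]; first by rewrite mulr_ge0.
have /andP[e0 e1] := e01.
have LL : L <= `|L| := ler_norm L.
case: i Y0 Db CP => Y0 _ CP.
  apply: le_trans (@ler_norm_telescope (Y eps ^~ n) eps C L e0 (Y0 eps n) _ m mL) _.
    by move=> k kL; exact: CP.
  by rewrite ler_wpM2l// (le_trans mL).
apply: le_trans (@ler_norm_telescope (Y eps m) eps C L e0 (Y0 eps m) _ n nL) _.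
  by move=> k kL; exact: CP.
by rewrite ler_wpM2l// (le_trans nL).
Qed.

Lemma gvanish_diff i X : gvanish i X -> gvanish i (gdiff (other i) X).
Proof.
by move=> X0 eps m; case: i X0 => X0; rewrite /gdiff /= !X0 subr0 mulr0.
Qed.

(** Quotients in direction [i] are bounded by hypothesis. A quotient in the other direction commutes
    with [gdiff i] and keeps the vanishing condition, so the induction hypothesis applies to it. *)
Lemma gBn_integrate s i Y : gvanish i Y -> gBn s (gdiff i Y) -> gBn s Y.
Proof.
elim: s Y => [|s IH] Y Y0 DB.
  by split=> //; exact: gbounded_integrate Y0 (gBn_bounded DB).
split=> [|j]; first exact: gbounded_integrate Y0 (gBn_bounded DB).
have [->|/axis_neq ->] := pselect (j = i); first exact: gBnW.
apply: IH; first exact: gvanish_diff.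
by rewrite gdiffC; exact: gBn_diff.
Qed.

(** * A priori bounds for the inhomogeneous discrete Moutard equation *)

Section Moutard.
Variables (X q sigma : R -> nat -> nat -> R).
Hypotheses (qB : forall s, gBn s q) (sigmaB : forall s, gBn s sigma).
Hypotheses (X1 : gvanish axis1 X) (X2 : gvanish axis2 X).
Hypothesis XE : forall eps m n, 0 < eps ->
  gdiff axis1 (gdiff axis2 X) eps m n =
  q eps m n * (X eps m.+1 n + X eps m n.+1) + sigma eps m n.

(* Both [X] and its difference in the second direction grow at most like
   [(1 + k * eps) ^+ (m + n)], which is bounded for [eps * m, eps * n <= L]. *)
Lemma moutard_gbounded : gbounded X.
Proof.
move=> L; have [Q Q0 QP] := gBn_bounded (qB 0%N) L.
have [P P0 PP] := gBn_bounded (sigmaB 0%N) L.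
(* With this value [k * k] is at least [2 * Q * (1 + k) + 1], which absorbs the right-hand side of
   the equation in [a7]. *)
pose k := 2 * Q + 2; have k0 : 0 < k by rewrite /k; lra.
exists (P * expR (k * (2 * L))) => [|eps m n e01 mL nL].
  by rewrite mulr_ge0 ?expR_ge0.
have /andP[e0 e1] := e01.
pose s := 1 + k * eps; have s1 : 1 <= s by rewrite lerDl mulr_ge0// ltW.
have bound : forall n m, eps * m%:R <= L -> eps * n%:R <= L ->
    `|X eps m n| <= P * s ^+ (m + n).
  elim=> [{mL nL n}m _ _|{nL}n IH {mL}m].
    by rewrite (X2 eps m) normr0 mulr_ge0// exprn_ge0// (le_trans _ s1).
  move=> mL nL; have nL' : eps * n%:R <= L.
    by apply: le_trans nL; rewrite ler_wpM2l ?(ltW e0)// ler_nat.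
  (* The difference bound carries an extra factor [k], so that adding [eps] times it to the bound in
     row [n] multiplies the latter by exactly [s]. *)
  have step (j : nat) : `|gdiff axis2 X eps j n| <= P * k * s ^+ (j + n) ->
      eps * j%:R <= L -> `|X eps j n.+1| <= P * s ^+ (j + n.+1).
    move=> vb jL.
    have -> : X eps j n.+1 = X eps j n + eps * gdiff axis2 X eps j n.
      by rewrite /gdiff /= mulVKf ?gt_eqF//; ring.
    apply: le_trans (ler_normD _ _) _; rewrite [`|eps * _|]normrM (gtr0_norm e0).
    apply: le_trans (lerD (IH _ jL nL') (ler_wpM2l (ltW e0) vb)) _.
    by rewrite addnS exprS /s le_eqVlt; apply/orP; left; apply/eqP; ring.
  (* Inner induction along the row for the difference in direction 2; it starts from 0 because [X]
     vanishes at first index 0. *)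
  apply: (step) => //; elim: m mL => [|m IHm] mL.
    by rewrite /gdiff /= !X1 subrr mulr0 normr0 !mulr_ge0 ?exprn_ge0 ?(ltW k0)// (le_trans _ s1).
  have mL' : eps * m%:R <= L.
    by apply: le_trans mL; rewrite ler_wpM2l ?(ltW e0)// ler_nat.
  have {}IHm := IHm mL'.
  have -> : gdiff axis2 X eps m.+1 n = gdiff axis2 X eps m n +
      eps * gdiff axis1 (gdiff axis2 X) eps m n.
    by set v := gdiff axis2 X; rewrite /gdiff /= mulVKf ?gt_eqF//; ring.
  rewrite XE//.
  set w := s ^+ (m + n).
  have w1 : 1 <= w by rewrite exprn_ege1.
  have a1 : `|X eps m.+1 n| <= P * s * w.
    by rewrite -mulrA -exprS -addSn; exact: IH.
  have a2 : `|X eps m n.+1| <= P * s * w.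
    by rewrite -mulrA -exprS -addnS; exact: step.
  have a3 : `|q eps m n| <= Q by exact: QP.
  have a4 : `|sigma eps m n| <= P by exact: PP.
  have a5 : `|q eps m n * (X eps m.+1 n + X eps m n.+1)| <= Q * (2 * (P * s * w)).
    rewrite normrM ler_pM//; apply: le_trans (ler_normD _ _) _; lra.
  have sk : s <= 1 + k by rewrite lerD2l ler_piMr// ltW.
  have Pw : P <= P * w by rewrite ler_peMr.
  have Pw0 : 0 <= P * w by rewrite mulr_ge0 ?(le_trans _ w1).
  have a6 : Q * (2 * (P * s * w)) <= Q * (2 * (P * w * (1 + k))).
    by rewrite mulrAC !ler_wpM2l.
  have a7 : Q * (2 * (P * w * (1 + k))) + P * w <= k * k * (P * w).
    suff : 0 <= (k * k - 1 - 2 * Q * (1 + k)) * (P * w) by lra.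
    by rewrite mulr_ge0// /k; nra.
  have a8 : `|q eps m n * (X eps m.+1 n + X eps m n.+1) + sigma eps m n| <=
      k * k * (P * w).
    by apply: le_trans (ler_normD _ _) _; lra.
  apply: le_trans (ler_normD _ _) _; rewrite [`|eps * _|]normrM (gtr0_norm e0).
  apply: le_trans (lerD IHm (ler_wpM2l (ltW e0) a8)) _.
  rewrite addSn exprS -/w /s le_eqVlt; apply/orP; left; apply/eqP; ring.
apply: le_trans (bound n m mL nL) _; rewrite ler_wpM2l//.
(* The power is compared with an exponential through [1 + x <= expR x], and [eps * (m + n)] is at
   most [2 * L]. *)
apply: (@le_trans _ _ (expR (k * eps) ^+ (m + n))).
  by rewrite lerXn2r ?nnegrE ?expR_ge0 ?expR_ge1Dx// (le_trans _ s1).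
rewrite -expRM_natl ler_expR.
have -> : (m + n)%:R * (k * eps) = k * (eps * m%:R + eps * n%:R).
  by rewrite natrD; ring.
by rewrite ler_wpM2l ?(ltW k0)//; lra.
Qed.

Theorem moutard_gBn s : gBn s X.
Proof.
elim: s => [|s IH]; first by split=> //; exact: moutard_gbounded.
have D12 : gBn s (gdiff axis1 (gdiff axis2 X)).
  apply: gBn_ext (gBnD (gBnM (qB s)
    (gBnD (gBn_shift axis1 IH) (gBn_shift axis2 IH))) (sigmaB s)) => eps e0.
  by apply/funext => m; apply/funext => n; rewrite XE.
split=> [|[]]; first exact: moutard_gbounded.
  apply: (@gBn_integrate _ axis2); last by rewrite gdiffC.
  exact: (@gvanish_diff axis2).
by apply: (@gBn_integrate _ axis1) => //; exact: (@gvanish_diff axis1).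
Qed.

End Moutard.
End GridFamilies.

(** * Consistency of the discrete equation with the differential one *)

Section Consistency.
Context {R : realType}.
Implicit Types (i j : axis) (eps L : R) (m n s : nat) (u : R * R).
Implicit Types (F : R * R -> R) (G H : R -> R * R -> R).

Definition sample G : R -> nat -> nat -> R :=
  fun eps m n => G eps (eps * m%:R, eps * n%:R).

(** The counterpart of [gdiff] on the whole plane, where it can still be differentiated. *)
Definition quot i G : R -> R * R -> R :=
  fun eps u => eps^-1 * (G eps (u + eps *: unit_vec i) - G eps u).

(** The truncation error of the forward difference, divided by the mesh once more because it is of
    first order. *)
Definition quot_error i G : R -> R * R -> R :=
  fun eps u => eps^-1 * (quot i G eps u - partial i (G eps) u).

Definition pbounded G : Prop := forall L, exists2 C, 0 <= C &
  forall eps u, 0 < eps <= 1 -> box L u -> `|G eps u| <= C.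

(* The analogue of gBn for partial derivatives of families of functions on the
   plane. *)
Fixpoint Un n G : Prop :=
  pbounded G /\
  if n is k.+1 then
    forall i, (forall eps u, derivable (G eps) u (unit_vec i)) /\
      Un k (fun eps => partial i (G eps))
  else True.

Lemma Un_pbounded n G : Un n G -> pbounded G.
Proof. by case: n => [|n] []. Qed.

Lemma Un_is_derive n G i eps u : Un n.+1 G ->
  is_derive u (unit_vec i) (G eps) (partial i (G eps) u).
Proof. by move=> [_ /(_ i)[/(_ eps u) ? _]]; exact: derivableP. Qed.

Lemma Un_partial n G i : Un n.+1 G -> Un n (fun eps => partial i (G eps)).
Proof. by move=> [_ /(_ i)[]]. Qed.

Lemma UnW n G : Un n.+1 G -> Un n G.
Proof.
elim: n G => [|n IH] G [Gb Gs]; split => // i.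
by have [dG /IH] := Gs i.
Qed.

Lemma Un_le m n G : (m <= n)%N -> Un n G -> Un m G.
Proof.
elim: n => [|n IH]; first by rewrite leqn0 => /eqP ->.
by rewrite leq_eqVlt => /orP[/eqP -> //|]; rewrite ltnS => /IH h /UnW.
Qed.

Lemma Cn_Un n F : Cn n F -> Un n (fun=> F).
Proof.
have b F' : continuous F' -> pbounded (fun=> F').
  by move=> Fc L; have [C C0 CP] := box_bounded L Fc; exists C => [|*];
    [exact: ltW|exact: CP].
elim: n F => [|n IH] F FC; split=> //; try exact/b/Cn_continuous/FC.
by move=> i; split=> [eps u|]; [have [] := Cn_is_derive i u FC|exact/IH/Cn_partial].
Qed.

Lemma is_derive_translate F u (a v : R * R) (d : R) :
  is_derive (u + a) v F d -> is_derive u v (fun w => F (w + a)) d.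
Proof.
have E : (fun h : R => h^-1 *: (((fun w => F (w + a)) \o shift u) (h *: v) - F (u + a)))
    = (fun h : R => h^-1 *: ((F \o shift (u + a)) (h *: v) - F (u + a))).
  by apply/funext => h /=; rewrite addrA.
by move=> [d1 d2]; split; move: d1 d2; rewrite /derivable /derive E.
Qed.

Lemma box_ray L eps u i (t : R) : 0 < eps <= 1 -> box L u -> `|t| <= `|eps| ->
  box (L + 1) (upd i u (crd i u + t)).
Proof.
move=> /andP[e0 e1] [u1 u2]; rewrite (gtr0_norm e0) => te.
have h w : `|w| <= L -> `|w + t| <= L + 1.
  by move=> wL; rewrite (le_trans (ler_normD _ _))//; lra.
by case: i; split => /=; rewrite ?h//; lra.
Qed.

Lemma addr_unit_vec i u (s : R) : u + s *: unit_vec i = upd i u (crd i u + s).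
Proof. by rewrite addrC shift_unit_vec addrC. Qed.

Lemma quot_pbounded i G : Un 1 G -> pbounded (quot i G).
Proof.
move=> GU L; have [C C0 CP] := Un_pbounded (Un_partial i GU) (L + 1).
exists C => // eps u e01 uL; have /andP[e0 _] := e01.
rewrite /quot normrM normfV mulrC ler_pdivrMr ?normr_gt0 ?gt_eqF//.
rewrite addr_unit_vec; apply: (ray_increment (k := partial i (G eps))) => [v|t te].
  exact: Un_is_derive GU.
by apply: CP => //; exact: box_ray te.
Qed.

Lemma is_derive_quot n i j G eps u : Un n.+1 G ->
  is_derive u (unit_vec j) (quot i G eps) (quot i (fun eps => partial j (G eps)) eps u).
Proof.
move=> GU; have d1 := is_derive_translate (Un_is_derive j eps (u + eps *: unit_vec i) GU).
exact: (is_deriveZ eps^-1 (is_deriveB d1 (Un_is_derive j eps u GU))).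
Qed.

Lemma partial_quot n i j G eps : Un n.+1 G ->
  partial j (quot i G eps) = quot i (fun eps => partial j (G eps)) eps.
Proof. by move=> GU; apply/funext => u; have [_] := is_derive_quot i j eps u GU. Qed.

(** Difference quotients commute with partial derivatives, and by the mean value estimate each costs
    one derivative and a box larger by 1. *)
Lemma Un_quot n i G : Un n.+1 G -> Un n (quot i G).
Proof.
elim: n G => [|n IH] G GU; first by split=> //; exact: quot_pbounded.
split=> [|j]; first by apply: quot_pbounded; exact: Un_le GU.
split=> [eps u|]; first by have [] := is_derive_quot i j eps u GU.
rewrite (_ : (fun eps => _) = quot i (fun eps => partial j (G eps))).
  exact/IH/Un_partial.
by apply/funext => eps; exact: partial_quot GU.
Qed.

Lemma mulr_natS eps k : eps * k.+1%:R = eps * k%:R + eps.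
Proof. by rewrite -natr1 mulrDr mulr1. Qed.

Lemma gdiff_sample i G : gdiff i (sample G) = sample (quot i G).
Proof.
apply/funext => eps; apply/funext => m; apply/funext => n.
rewrite /gdiff /sample /quot addr_unit_vec.
by case: i; rewrite /= mulr_natS.
Qed.

Lemma gbounded_sample G : pbounded G -> gbounded (sample G).
Proof.
move=> Gb L; have [C C0 CP] := Gb L; exists C => // eps m n e01 mL nL.
have /andP[e0 _] := e01.
by apply: CP => //; split=> /=; rewrite ger0_norm// mulr_ge0// ltW.
Qed.

Lemma gBn_sample n G : Un n G -> gBn n (sample G).
Proof.
elim: n G => [|n IH] G GU.
  by split=> //; apply: gbounded_sample; exact: Un_pbounded GU.
split=> [|i]; first by apply: gbounded_sample; exact: Un_pbounded GU.
by rewrite gdiff_sample; exact/IH/Un_quot.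
Qed.

(** The second derivative bounds the oscillation of the first by a multiple of [eps], so the Taylor
    remainder is of order [eps ^+ 2] and survives both divisions by [eps]. *)
Lemma quot_error_pbounded i G : Un 2 G -> pbounded (quot_error i G).
Proof.
move=> GU L; have [C C0 CP] := Un_pbounded (Un_partial i (Un_partial i GU)) (L + 1).
exists C => // eps u e01 uL; have /andP[e0 _] := e01.
have en : 0 < `|eps| by rewrite normr_gt0 gt_eqF.
rewrite /quot_error /quot normrM normfV mulrC ler_pdivrMr//.
set a := _ - _; have -> : a = eps^-1 *
    (G eps (upd i u (crd i u + eps)) - G eps u - eps * partial i (G eps) u).
  by rewrite [RHS]mulrBr mulKf ?gt_eqF// /a addr_unit_vec.
rewrite normrM normfV mulrC ler_pdivrMr//.
apply: (taylor1 (k := partial i (G eps))) => [v|t te].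
  exact: Un_is_derive GU.
apply: le_trans (_ : C * `|t| <= _); last by rewrite ler_wpM2l.
apply: (ray_increment (k := partial i (partial i (G eps)))) => [v|r rt].
  exact: Un_is_derive (Un_partial i GU).
by apply: CP => //; apply: box_ray (e01) uL _; exact: le_trans te.
Qed.

(* Every quot j commutes with quot_error i, so the symmetry of mixed partial
   derivatives is not needed. *)
Lemma gBn_sample_quot_error n i G : Un n.+2 G -> gBn n (sample (quot_error i G)).
Proof.
elim: n G => [|n IH] G GU.
  by split=> //; apply/gbounded_sample/quot_error_pbounded.
split=> [|j]; first by apply/gbounded_sample/quot_error_pbounded; exact: Un_le GU.
rewrite gdiff_sample (_ : quot j _ = quot_error i (quot j G)).
  exact/IH/Un_quot.
apply/funext => eps; apply/funext => u.
rewrite /quot_error (partial_quot _ _ _ GU) /quot.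
rewrite (addrAC u (eps *: unit_vec j) (eps *: unit_vec i)); ring.
Qed.

Theorem grid_convergence (q F : R * R -> R) (g : R -> nat -> nat -> R) :
  smooth_on setT q -> smooth_on setT F ->
  (forall u, partial axis1 (partial axis2 F) u = q u * F u) ->
  (forall eps m n, 0 < eps -> g eps m.+1 n.+1 + g eps m n =
     (1 + 2^-1 * eps ^+ 2 * q (eps * m%:R, eps * n%:R)) *
     (g eps m.+1 n + g eps m n.+1)) ->
  (forall eps m, g eps m 0%N = F (eps * m%:R, 0)) ->
  (forall eps n, g eps 0%N n = F (0, eps * n%:R)) ->
  forall s, gBn s (fun eps m n => eps^-1 * (g eps m n - F (eps * m%:R, eps * n%:R))).
Proof.
move=> /smooth_onT_Cn qC /smooth_onT_Cn FC pde dpde g1 g2.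
have FU n : Un n (fun=> F) by exact: Cn_Un.
have F2U n : Un n (fun=> partial axis2 F) by exact: Un_partial (FU n.+1).
pose qs := sample (fun=> q); pose Fs := sample (fun=> F).
pose T2F := sample (quot_error axis2 (fun=> F)).
pose T1F2 := sample (quot_error axis1 (fun=> partial axis2 F)).
(* With T2 and T1 the scaled truncation errors, delta_1 delta_2 F = d_1 d_2 F + eps (delta_1 T2 +
   T1), while q/2 (tau_1 F + tau_2 F) = q F + eps q/2 (delta_1 F + delta_2 F). Subtracting, the
   terms of order zero cancel by the differential equation and [sigma] is what remains after
   division by [eps]. *)
pose sigma eps m n := (2^-1 * qs eps m n * (gdiff axis1 Fs eps m n + gdiff axis2 Fs eps m n))
  + (-1) * (gdiff axis1 T2F eps m n + T1F2 eps m n).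
apply: (@moutard_gBn _ _ (fun eps m n => 2^-1 * qs eps m n) sigma).
- by move=> s; apply: gBnM; [exact: gBn_cst|apply/gBn_sample/Cn_Un].
- move=> s; apply: gBnD.
    apply: gBnM; first by apply: gBnM; [exact: gBn_cst|apply/gBn_sample/Cn_Un].
    by apply: gBnD; apply: gBn_diff; exact: gBn_sample.
  apply: gBnM; first exact: gBn_cst.
  by apply: gBnD; [apply: gBn_diff|]; exact: gBn_sample_quot_error.
- by move=> eps m; rewrite g2 mulr0 subrr mulr0.
- by move=> eps m; rewrite g1 mulr0 subrr mulr0.
move=> eps m n e0.
have e_neq0 : eps != 0 by rewrite gt_eqF.
have := dpde eps m n e0; have := pde (eps * m%:R, eps * n%:R).
rewrite /sigma /T2F /T1F2 gdiff_sample /gdiff /=.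
rewrite /qs /Fs /sample /quot_error /quot !addr_unit_vec /=.
rewrite !mulr_natS.
move=> -> dp.
have -> : g eps m.+1 n.+1 = (1 + 2^-1 * eps ^+ 2 * q (eps * m%:R, eps * n%:R)) *
    (g eps m.+1 n + g eps m n.+1) - g eps m n by rewrite -dp; ring.
by field.
Qed.

End Consistency.

(** * Passage between row vectors and their coordinates *)

Section Rows.
Context {R : realType} {N : nat}.

Lemma ler_norm_row (x : 'rV[R]_N) (c : R) : 0 <= c ->
  (forall j, `|x ord0 j| <= c) -> `|x| <= c.
Proof.
move=> c0 xc; rewrite /Num.Def.normr/= mx_normrE bigmax_le//= => -[i j] _ /=.
by rewrite ord1.
Qed.

Lemma continuous_row (T : topologicalType) (f : T -> 'rV[R]_N) (x : T) :
  (forall j, {for x, continuous (fun y => f y ord0 j)}) -> {for x, continuous f}.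
Proof.
move=> fx; apply/cvgrPdist_le => /= e e0.
have : \forall y \near x, forall j, `|f x ord0 j - f y ord0 j| <= e.
  apply: filter_forall => j; have /cvgrPdist_le := fx j; exact.
apply: filterS => y xy; apply: ler_norm_row; first exact: ltW.
by move=> j; rewrite !mxE.
Qed.

Lemma is_derive_coord (V : normedModType R) (f : V -> 'rV[R]_N) x v (d : 'rV[R]_N) j :
  is_derive x v f d -> is_derive x v (fun y => f y ord0 j) (d ord0 j).
Proof.
move=> [df <-]; split; first by have /derivable_mxP := df; apply.
by rewrite derive_mx// mxE.
Qed.

Lemma is_derive_row (V : normedModType R) (f : V -> 'rV[R]_N) x v (d : 'rV[R]_N) :
  (forall j, is_derive x v (fun y => f y ord0 j) (d ord0 j)) -> is_derive x v f d.
Proof.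
move=> fd; have df : derivable f x v.
  by apply/derivable_mxP => i j; rewrite ord1; have [] := fd j.
split=> //; rewrite derive_mx//; apply/rowP => j; rewrite mxE.
by have [] := fd j.
Qed.

Lemma smooth_curve_coord (c : R -> 'rV[R]_N) j :
  smooth_curve c -> smooth_curve (fun t => c t ord0 j).
Proof.
move=> cs; have E n : derive1n n (fun t => c t ord0 j) = (fun t => derive1n n c t ord0 j).
  elim: n => [//|n IH]; apply/funext => t.
  rewrite !derive1nS IH !derive1E.
  by have [] := is_derive_coord j (derivableP (cs n t)).
by move=> n t; rewrite E; have [] := is_derive_coord j (derivableP (cs n t)).
Qed.

(** The coordinatewise formula at [w] yields derivability there, which in turn yields the formula
    for words one letter longer. *)
Lemma partials_row (F : 'I_N -> R * R -> R) w :
  (forall j, smooth_on setT (F j)) ->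
  partials w (fun u => \row_j F j u) = (fun u => \row_j partials w (F j) u) /\
  forall i u, is_derive u (unit_vec i) (partials w (fun u => \row_j F j u))
    (\row_j partial i (partials w (F j)) u).
Proof.
move=> Fs.
have D w' : partials w' (fun u => \row_j F j u) = (fun u => \row_j partials w' (F j) u) ->
  forall i u, is_derive u (unit_vec i) (partials w' (fun u => \row_j F j u))
    (\row_j partial i (partials w' (F j)) u).
  move=> -> i u; apply: is_derive_row => j.
  rewrite mxE (_ : (fun y => _) = partials w' (F j)); last first.
    by apply/funext => y; rewrite mxE.
  by apply: derivableP; have [/(_ i)] := Fs j w' u I.
suff E : partials w (fun u => \row_j F j u) = (fun u => \row_j partials w (F j) u).
  by split=> //; exact: D.
elim: w => [//|i w IH] /=; apply/funext => u.
by rewrite /partial; have [_ ->] := D w IH i u.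
Qed.

Lemma smooth_on_row (F : 'I_N -> R * R -> R) :
  (forall j, smooth_on setT (F j)) -> smooth_on setT (fun u => \row_j F j u).
Proof.
move=> Fs w u _; have [E D] := partials_row w Fs.
split=> [i|]; first by have [] := D i u.
rewrite E; apply: continuous_row => j.
rewrite (_ : (fun y => _) = partials w (F j)); first by have [] := Fs j w u I.
by apply/funext => y; rewrite mxE.
Qed.

Lemma goursat_row (q : R * R -> R) (c1 c2 : R -> 'rV[R]_N) :
  smooth_on setT q -> smooth_curve c1 -> smooth_curve c2 -> c1 0 = c2 0 ->
  exists F : 'I_N -> R * R -> R,
    [/\ forall j, smooth_on setT (F j),
        forall j u, partial axis1 (partial axis2 (F j)) u = q u * F j u,
        forall x, \row_j F j (x, 0) = c1 x & forall y, \row_j F j (0, y) = c2 y].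
Proof.
move=> qs c1s c2s c12.
have /choice [F FP] : forall j, exists F : R * R -> R, [/\ smooth_on setT F,
    forall u, partial axis1 (partial axis2 F) u = q u * F u,
    forall x, F (x, 0) = c1 x ord0 j & forall y, F (0, y) = c2 y ord0 j].
  move=> j; apply: goursat => //; [exact: smooth_curve_coord|exact: smooth_curve_coord|].
  by rewrite c12.
exists F; split=> [j|j|x|y]; try by have [] := FP j.
  by apply/rowP => j; rewrite mxE; have [] := FP j.
by apply/rowP => j; rewrite mxE; have [] := FP j.
Qed.

End Rows.

(** * Uniqueness for the Moutard equation on a small square *)

Section Uniqueness.
Context {R : realType}.
Implicit Types (u : R * R) (r Q B : R).

Lemma square_bounded (G : R * R -> R) r :
  (forall u, square r u -> {for u, continuous G}) ->
  exists2 B, 0 <= B & forall u, square r u -> `|G u| <= B.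
Proof.
move=> Gc.
have sE : square r = `[0, r]%classic `*` `[0, r]%classic.
  by apply/seteqP; split=> u /=; rewrite /square /= !in_itv.
have cK : compact (square r) by rewrite sE; apply: compact_setX; exact: segment_compact.
have /compact_bounded [M [_ MP]] : compact (G @` square r).
  apply: continuous_compact => //; apply: continuous_in_subspaceT => u.
  by rewrite inE => /Gc.
exists (`|M| + 1) => [|u ur]; first by rewrite addr_ge0.
by apply: MP; [rewrite (le_lt_trans (ler_norm M))// ltrDl|exists u].
Qed.

(** Any bound of [G] on the square can be halved; iterating forces [G] to vanish. *)
Lemma moutard_unique (q G G2 : R * R -> R) r Q : 0 < r -> 0 <= Q -> r * r * Q <= 2^-1 ->
  (forall u, square r u -> `|q u| <= Q) ->
  (forall u, square r u -> {for u, continuous G}) ->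
  (forall u, square r u -> is_derive u (unit_vec axis2) G (G2 u)) ->
  (forall u, square r u -> is_derive u (unit_vec axis1) G2 (q u * G u)) ->
  (forall u, square r u -> axis_line axis1 u -> G u = 0) ->
  (forall u, square r u -> axis_line axis2 u -> G u = 0) ->
  forall u, square r u -> G u = 0.
Proof.
move=> r0 Q0 rQ qQ Gc dG dG2 Gx Gy.
(* Strict inequalities keep a neighbourhood of [y] on the axis inside the square, so that the
   two-sided derivative sees only zeros of [G]. *)
have G20 y : 0 < y < r -> G2 (0, y) = 0.
  move=> /andP[y0 yr].
  have ys : square r (0, y) by split; rewrite /= ?lexx ?(ltW r0) ?(ltW y0) ?(ltW yr).
  have /is_derive_line [_ <-] := dG _ ys.
  transitivity ('D_1 (cst (0 : R)) y); last by rewrite derive_cst.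
  apply: near_eq_derive => /=; near=> t.
  have t0 : 0 < t by near: t; exact: lt_nbhsr.
  have tr : t < r by near: t; exact: lt_nbhsl.
  by apply: Gy => //; split; rewrite /= ?lexx ?(ltW r0) ?(ltW t0) ?(ltW tr).
(* Along the vertical segment the mean value theorem gives an interior [t] with
   [G (x, y) = G2 (x, t) * y]; integrating the equation from [G2 (0, t) = 0] bounds [G2 (x, t)] by
   [Q * B * x]. The product is at most [B * (r * r * Q)]. *)
have half B : 0 <= B -> (forall u, square r u -> `|G u| <= B) ->
    forall u, square r u -> `|G u| <= B * 2^-1.
  move=> B0 GB [x y] [/= /andP[x0 xr] /andP[y0 yr]].
  have [y00|yn0] := eqVneq y 0.
    rewrite Gx ?normr0 ?mulr_ge0//; first by split; rewrite /= ?x0 ?y0.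
  have yp : 0 < y by rewrite lt_neqAle eq_sym yn0.
  have line t : 0 <= t <= y -> is_derive t 1 (fun t => G (x, t)) (G2 (x, t)).
    move=> /andP[t0 ty]; have ts : square r (x, t).
      by split; rewrite /= ?x0 ?t0//= (le_trans ty).
    exact: (is_derive_line G axis2 (x, t) _).1 (dG _ ts).
  have [t ty E] : exists2 t, t \in `]0, y[ & G (x, y) - G (x, 0) = G2 (x, t) * (y - 0).
    apply: (@MVT _ (fun t => G (x, t)) (fun t => G2 (x, t))) => //.
      by move=> t; rewrite in_itv/= => /andP[t0 ty]; apply: line; rewrite !ltW.
    apply: derivable_within_continuous => t; rewrite in_itv/= => ty.
    by have [] := line t ty.
  move: ty E; rewrite in_itv/= => /andP[t0 ty].
  rewrite [G (x, 0)]Gx ?subr0//; last by split; rewrite /= ?x0 ?lexx ?(ltW r0).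
  move=> ->.
  have G2b : `|G2 (x, t)| <= Q * B * x.
    have := @ler_increment_cst _ (fun s => G2 (s, t)) (fun s => q (s, t) * G (s, t)) 0 x (Q * B) x0.
    rewrite G20 ?t0 ?(lt_le_trans ty)// !subr0; apply => s /andP[s0 sx];
      have ss : square r (s, t) by
        split; rewrite /= ?s0 ?(ltW t0)/= ?(le_trans sx)// (le_trans (ltW ty)).
      exact: (is_derive_line G2 axis1 (s, t) _).1 (dG2 _ ss).
    by rewrite normrM ler_pM ?qQ ?GB.
  rewrite normrM (gtr0_norm yp).
  apply: (@le_trans _ _ (Q * B * r * r)).
    apply: ler_pM => //; rewrite ?(ltW yp)// (le_trans G2b)//.
    by rewrite ler_wpM2l ?mulr_ge0.
  have -> : Q * B * r * r = B * (r * r * Q) by ring.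
  by rewrite ler_wpM2l.
have [B B0 GB] := square_bounded Gc.
have GBn n : forall u, square r u -> `|G u| <= B * 2^-1 ^+ n.
  elim: n => [|n IH] u us; first by rewrite expr0 mulr1; exact: GB.
  by rewrite exprSr mulrA; apply: half => //; rewrite mulr_ge0 ?exprn_ge0 ?invr_ge0.
move=> u us; apply/eqP; rewrite -normr_le0; apply/ler_addgt0Pr => e e0.
by rewrite add0r; have [n /ltW nP] := geometric_lt B e0; exact: le_trans (GBn n u us) nP.
Unshelve. all: by end_near. Qed.

End Uniqueness.

(** * Solving the discrete equation from its values on the axes *)

Section GridSolutions.
Context {R : realType} {V : lmodType R}.
Variables (a : nat -> nat -> R) (b1 b2 : nat -> V).

(** The equation is solved for the far corner of each cell, row by row and from left to right within
    a row. At the origin the value is taken from [b1]. *)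
Fixpoint grid_row n : nat -> V :=
  if n is k.+1 then
    fix row m := if m is l.+1
      then a l k *: (grid_row k l.+1 + row l) - grid_row k l
      else b2 k.+1
  else b1.

Definition grid_sol m n : V := grid_row n m.

Lemma grid_sol_axis2 n : b1 0%N = b2 0%N -> grid_sol 0 n = b2 n.
Proof. by case: n. Qed.

Lemma grid_solE m n : grid_sol m.+1 n.+1 + grid_sol m n =
  a m n *: (grid_sol m.+1 n + grid_sol m n.+1).
Proof. by rewrite /grid_sol /= subrK. Qed.

End GridSolutions.

(** * Discrete nets on lattice points versus grid functions of natural indices *)

Section LatticeBridge.
Context {R : realType} {N : nat}.
Implicit Types (eps r : R) (m n k l : nat) (G : R -> R * R -> 'rV[R]_N).
Implicit Types (X Y : R -> nat -> nat -> R).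

Definition gpoint eps m n : R * R := (eps * m%:R, eps * n%:R).

Definition coord_sample j G : R -> nat -> nat -> R :=
  fun eps m n => G eps (gpoint eps m n) ord0 j.

Lemma gpointS eps m n i :
  gpoint eps m n + eps *: unit_vec i = gshift i (gpoint eps) m n.
Proof. by rewrite addr_unit_vec; case: i; rewrite /gpoint /= mulr_natS. Qed.

Lemma gpoint_step eps m n :
  (gpoint eps m n + eps *: unit_vec axis1 = gpoint eps m.+1 n) *
  (gpoint eps m n + eps *: unit_vec axis2 = gpoint eps m n.+1).
Proof. by split; rewrite gpointS. Qed.

Lemma coord_sample_delta j G i :
  coord_sample j (fun eps => delta eps i (G eps)) = gdiff i (coord_sample j G).
Proof.
apply/funext => eps; apply/funext => m; apply/funext => n.
rewrite /coord_sample /delta /tau gpointS !mxE /gdiff.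
by case: i.
Qed.

Lemma coord_sample_delta_multi j G k l :
  coord_sample j (fun eps => delta_multi eps k l (G eps)) =
  iter k (gdiff axis1) (iter l (gdiff axis2) (coord_sample j G)).
Proof.
elim: k => [|k IH] /=; last by rewrite -IH -coord_sample_delta.
by elim: l => [//|l IH] /=; rewrite -IH -coord_sample_delta.
Qed.

Lemma gdiff_local eps c i k l X Y :
  (forall m n, (m <= if i is axis1 then k.+1 else k)%N ->
     (n <= if i is axis2 then l.+1 else l)%N -> X eps m n = c * Y eps m n) ->
  forall m n, (m <= k)%N -> (n <= l)%N -> gdiff i X eps m n = c * gdiff i Y eps m n.
Proof.
by case: i => XY m n mk nl; rewrite /gdiff /= !XY// ?(leq_trans mk)// ?(leq_trans nl)//;
  ring.
Qed.

(** A quotient of order (k, l) reads indices at most k and l further on. Hence a net known only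
    inside the square may be replaced there by the grid solution; the bounds [K] and [L] leave the
    room that the induction consumes. *)
Lemma gdiff_iter_local eps c k l K L X Y :
  (forall m n, (m <= K + k)%N -> (n <= L + l)%N -> X eps m n = c * Y eps m n) ->
  forall m n, (m <= K)%N -> (n <= L)%N ->
    iter k (gdiff axis1) (iter l (gdiff axis2) X) eps m n =
    c * iter k (gdiff axis1) (iter l (gdiff axis2) Y) eps m n.
Proof.
elim: k K => [|k IH] K XY.
  rewrite addn0 in XY; elim: l L XY => [|l IHl] L XY; first by rewrite addn0 in XY.
  apply: (@gdiff_local _ _ axis2) => m n mK nL.
  by apply: IHl mK nL => m' n'; rewrite addSnnS; exact: XY.
apply: (@gdiff_local _ _ axis1) => m n mK nL.
by apply: IH mK nL => m' n'; rewrite addSnnS; exact: XY.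
Qed.

Lemma gBn_iter s k i X : gBn (k + s) X -> gBn s (iter k (gdiff i) X).
Proof.
elim: k s => [//|k IH] s XB /=; apply: gBn_diff; apply: IH.
by rewrite addnS.
Qed.

Lemma lattice_squareP eps r u : 0 < eps -> lattice_square eps r u ->
  exists m n, [/\ u = gpoint eps m n, eps * m%:R <= r & eps * n%:R <= r].
Proof.
move=> e0 [[m [n ->]] [/= /andP[m0 mr] /andP[n0 nr]]].
move: m0 n0; rewrite !pmulr_rge0// !ler0z => m0 n0.
by exists `|m|%N, `|n|%N; rewrite /gpoint !natr_absz !ger0_norm.
Qed.

Lemma lattice_square_gpoint eps r m n : 0 < eps ->
  eps * m%:R <= r -> eps * n%:R <= r -> lattice_square eps r (gpoint eps m n).
Proof.
move=> e0 mr nr; split; first by exists m%:Z, n%:Z.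
by split; rewrite /= ?mr ?nr andbT mulr_ge0// ltW.
Qed.

Variables (c1 c2 : R -> 'rV[R]_N) (q : R * R -> R).
Hypothesis c12 : c1 0 = c2 0.

Definition moutard_grid eps : nat -> nat -> 'rV[R]_N :=
  grid_sol (fun m n => 1 + 2^-1 * eps ^+ 2 * q (gpoint eps m n))
    (fun m => c1 (eps * m%:R)) (fun n => c2 (eps * n%:R)).

Lemma moutard_grid_axis2 eps n : moutard_grid eps 0 n = c2 (eps * n%:R).
Proof. by apply: grid_sol_axis2; rewrite !mulr0. Qed.

Lemma moutard_gridE eps m n :
  moutard_grid eps m.+1 n.+1 + moutard_grid eps m n =
  (1 + 2^-1 * eps ^+ 2 * q (gpoint eps m n)) *:
    (moutard_grid eps m.+1 n + moutard_grid eps m n.+1).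
Proof. exact: grid_solE. Qed.

Lemma canonical_discrete_Mnet_ex eps r : 0 < eps ->
  exists g, canonical_discrete_Mnet eps (lattice_square eps r) c1 c2 q g.
Proof.
move=> e0.
(* Truncation recovers the indices of a lattice point; values elsewhere are irrelevant. *)
pose g (u : R * R) := moutard_grid eps (Num.truncn (eps^-1 * u.1)) (Num.truncn (eps^-1 * u.2)).
have gE m n : g (gpoint eps m n) = moutard_grid eps m n.
  by rewrite /g /= !mulKf ?gt_eqF// !natrK.
exists g; split=> [u us _ _ _|].
  have [m [n [-> _ _]]] := lattice_squareP e0 us.
  by rewrite /tau !gpoint_step !gE; exact: moutard_gridE.
split=> u us /= u0; have [m [n [uE _ _]]] := lattice_squareP e0 us.
  move: u0; rewrite {}uE gE /= => /eqP; rewrite mulf_eq0 gt_eqF//= pnatr_eq0 => /eqP ->.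
  by [].
move: u0; rewrite {}uE gE /= => /eqP; rewrite mulf_eq0 gt_eqF//= pnatr_eq0 => /eqP ->.
exact: moutard_grid_axis2.
Qed.

(** The equation on a cell determines its far corner from the other three, and these cells stay in
    the square. *)
Lemma canonical_discrete_Mnet_unique eps r g : 0 < eps ->
  canonical_discrete_Mnet eps (lattice_square eps r) c1 c2 q g ->
  forall m n, eps * m%:R <= r -> eps * n%:R <= r ->
    g (gpoint eps m n) = moutard_grid eps m n.
Proof.
move=> e0 [gM [g1 g2]] m n; elim: n m => [|n IHn] m mr nr.
  rewrite g1//; first exact: lattice_square_gpoint.
  by rewrite /= mulr0.
elim: m mr => [|m IHm] mr.
  rewrite g2 ?moutard_grid_axis2//.
    exact: lattice_square_gpoint.
  by rewrite /= mulr0.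
have le k : eps * k.+1%:R <= r -> eps * k%:R <= r.
  by apply: le_trans; rewrite ler_wpM2l ?(ltW e0)// ler_nat.
have mr' := le m mr; have nr' := le n nr.
have sq k l : eps * k%:R <= r -> eps * l%:R <= r ->
    lattice_square eps r (gpoint eps k l) by exact: lattice_square_gpoint.
have := gM (gpoint eps m n); rewrite /tau !gpoint_step.
move=> /(_ (sq _ _ mr' nr') (sq _ _ mr nr') (sq _ _ mr' nr) (sq _ _ mr nr)).
rewrite (IHn m mr' nr') (IHn m.+1 mr nr') (IHm mr') -moutard_gridE.
exact: addIr.
Qed.

End LatticeBridge.


(** * Existence, uniqueness and convergence for vector-valued nets *)

Section MainTheorem.
Context {R : realType} {N : nat}.
Variables (c1 c2 : R -> 'rV[R]_N) (q : R * R -> R).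
Hypotheses (c12 : c1 0 = c2 0) (smooth_q : smooth_on setT q).
Variable F : 'I_N -> R * R -> R.
Hypotheses (smooth_F : forall j, smooth_on setT (F j))
  (FE : forall j u, partial axis1 (partial axis2 (F j)) u = q u * F j u)
  (F1 : forall x, \row_j F j (x, 0) = c1 x)
  (F2 : forall y, \row_j F j (0, y) = c2 y).

Let f u := \row_j F j u.

Lemma row_Mnet_with_data r : Mnet_with_data (square r) c1 c2 q f.
Proof.
split; last first.
  by split=> -[x y] _ /= ->; rewrite /f; [exact: F1|exact: F2].
exists setT, f; split=> //; first exact: openT.
  exact: smooth_on_row.
move=> u _; have [E _] := @partials_row _ _ _ [:: axis1; axis2] smooth_F.
have /= -> := congr1 (@^~ u) E.
by apply/rowP => j; rewrite !mxE FE.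
Qed.

Lemma Mnet_with_data_unique r Q g : 0 < r -> 0 <= Q -> r * r * Q <= 2^-1 ->
  (forall u, square r u -> `|q u| <= Q) ->
  Mnet_with_data (square r) c1 c2 q g -> forall u, square r u -> g u = f u.
Proof.
move=> r0 Q0 rQ qQ [[U [G [_ sU Gs Gg GE]]] [g1 g2]] u us.
apply/rowP => j; apply/eqP; rewrite -subr_eq0 -Gg// [f u ord0 j]mxE; apply/eqP.
(* The extension [G] is used in place of [g], since it is differentiable at the boundary of the
   square as well. *)
pose H u := G u ord0 j - F j u.
pose H2 u := partial axis2 G u ord0 j - partial axis2 (F j) u.
apply: (@moutard_unique _ q H H2 r Q) us => //.
- move=> v vs; apply: continuousB; last by have [] := @smooth_F j [::] v I.
  have [_ Gc] := Gs [::] v (sU _ vs).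
  apply: (@continuous_comp _ _ _ G (fun M : 'rV[R]_N => M ord0 j)) => //.
  exact: coord_continuous.
- move=> v vs; have [/(_ axis2) dG _] := Gs [::] v (sU _ vs).
  have [/(_ axis2) dF _] := @smooth_F j [::] v I.
  exact: (is_deriveB (is_derive_coord j (derivableP dG)) (derivableP dF)).
- move=> v vs; have [/(_ axis1) dG _] := Gs [:: axis2] v (sU _ vs).
  have [/(_ axis1) dF _] := @smooth_F j [:: axis2] v I.
  have : is_derive v (unit_vec axis1) H2 (partial axis1 (partial axis2 G) v ord0 j
      - partial axis1 (partial axis2 (F j)) v).
    exact: (is_deriveB (is_derive_coord j (derivableP dG)) (derivableP dF)).
  by rewrite FE (GE v vs) mxE -mulrBr.
- move=> [x y] vs /= y0; rewrite /H Gg// g1// -F1 mxE /= y0; exact: subrr.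
- move=> [x y] vs /= x0; rewrite /H Gg// g2// -F2 mxE /= x0; exact: subrr.
Qed.

Lemma canonical_discrete_Mnet_converges r (fe : R -> R * R -> 'rV[R]_N) :
  (forall eps, 0 < eps ->
     canonical_discrete_Mnet eps (lattice_square eps r) c1 c2 q (fe eps)) ->
  converges_Oeps_Coo r fe f.
Proof.
move=> feM k l.
pose X j eps m n :=
  eps^-1 * (moutard_grid c1 c2 q eps m n ord0 j - F j (gpoint eps m n)).
have XB j s : gBn s (X j).
  apply: (@grid_convergence _ q (F j) (fun eps m n => moutard_grid c1 c2 q eps m n ord0 j)) => //.
  - move=> eps m n e0; have := moutard_gridE c1 c2 q eps m n.
    by move=> /(congr1 (fun M : 'rV[R]_N => M ord0 j)); rewrite !mxE.
  - by move=> eps m; rewrite -[LHS]/(c1 _ ord0 j) -F1 mxE.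
  - by move=> eps n; rewrite moutard_grid_axis2// -F2 mxE.
have /choice [C CP] : forall j, exists C : R, 0 <= C /\ forall eps m n, 0 < eps <= 1 ->
    eps * m%:R <= r -> eps * n%:R <= r ->
    `|iter k (gdiff axis1) (iter l (gdiff axis2) (X j)) eps m n| <= C.
  move=> j.
  have kl := @gBn_iter R 0 k axis1 _ (@gBn_iter R (k + 0) l axis2 _ (XB j (l + (k + 0))%N)).
  by have [C C0 CP] := gBn_bounded kl r; exists C; split=> // eps m n; exact: CP.
(* The sum dominates the constant of every coordinate, hence the maximum norm; the threshold 1 is
   the mesh bound built into [gbounded]. *)
exists (\sum_j C j), 1 => // eps /andP[e0 e1] u us us'.
have C0 : 0 <= \sum_j C j by apply: sumr_ge0 => j _; have [] := CP j.
have [m [n [uE mr nr]]] := lattice_squareP e0 us.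
have [m' [n' [uE' mr' nr']]] := lattice_squareP e0 us'.
have [mk nl] : eps * (m + k)%:R <= r /\ eps * (n + l)%:R <= r.
  have [_ [/= /andP[_ h1] /andP[_ h2]]] := us'; rewrite uE /= in h1 h2.
  by rewrite !natrD !mulrDr; split.
apply: ler_norm_row => [|j]; first by rewrite mulr_ge0// ltW.
have -> : delta_multi eps k l (fe eps \- f) u ord0 j =
    coord_sample j (fun eps => delta_multi eps k l (fe eps \- f)) eps m n.
  by rewrite /coord_sample -uE.
rewrite (coord_sample_delta_multi j (fun eps => fe eps \- f)).
(* The error is [eps] times the scaled error [X], whose quotients are bounded: this factor is the
   order of convergence. *)
rewrite (@gdiff_iter_local _ eps eps k l m n _ (X j))//; last first.
  move=> i p im pn; rewrite /X mulVKf ?gt_eqF// /coord_sample.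
  rewrite -(canonical_discrete_Mnet_unique c12 e0 (feM _ e0)); last 2 first.
  - by apply: le_trans mk; rewrite ler_wpM2l ?(ltW e0)// ler_nat.
  - by apply: le_trans nl; rewrite ler_wpM2l ?(ltW e0)// ler_nat.
  by rewrite !mxE.
rewrite normrM (gtr0_norm e0) mulrC ler_wpM2r ?(ltW e0)//.
have [_ CPj] := CP j; apply: le_trans (CPj eps m n _ mr nr) _; first by rewrite e0 ltW.
rewrite (bigD1 j)//= lerDl sumr_ge0// => i _; by have [] := CP i.
Qed.

End MainTheorem.

Theorem theorem3p12 (R : realType) (N : nat)
    (c1 c2 : R -> 'rV[R]_N) (q : R * R -> R)
    (smooth_c1 : smooth_curve c1) (smooth_c2 : smooth_curve c2)
    (common_point : c1 0 = c2 0) (smooth_q : smooth_on setT q) :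
  exists2 r : R, 0 < r &
  exists f : R * R -> 'rV[R]_N,
    [/\ Mnet_with_data (square r) c1 c2 q f,
        (forall g : R * R -> 'rV[R]_N, Mnet_with_data (square r) c1 c2 q g ->
           forall u, square r u -> g u = f u),
        (forall eps : R, 0 < eps -> exists g : R * R -> 'rV[R]_N,
           canonical_discrete_Mnet eps (lattice_square eps r) c1 c2 q g)
      & (forall fe : R -> R * R -> 'rV[R]_N,
           (forall eps : R, 0 < eps ->
              canonical_discrete_Mnet eps (lattice_square eps r) c1 c2 q
                (fe eps)) ->
           converges_Oeps_Coo r fe f)].
Proof.
have [F [Fs FE F1 F2]] := goursat_row smooth_q smooth_c1 smooth_c2 common_point.
have qc : continuous q by move=> u; have [] := smooth_q [::] u I.
have [Q Q0 qQ] := box_bounded 1 qc.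
(* The side is dictated by uniqueness: it is at most 1, so that [Q] bounds [q] on the square, and
   its product with [Q] is at most 1/2. *)
have r0 : 0 < (2 * Q + 1)^-1 by rewrite invr_gt0; lra.
have r1 : (2 * Q + 1)^-1 <= 1 by rewrite invf_le1; lra.
have rQ : (2 * Q + 1)^-1 * Q <= 2^-1.
  by rewrite mulrC ler_pdivrMr; lra.
exists (2 * Q + 1)^-1 => //; exists (fun u => \row_j F j u); split.
- exact: row_Mnet_with_data.
- move=> g; apply: (Mnet_with_data_unique Fs FE F1 F2 (Q := Q)) => //.
  + exact: ltW.
  + by rewrite -mulrA (le_trans _ rQ)// ler_piMl// mulr_ge0// ltW.
  + move=> u [/andP[u1 u1r] /andP[u2 u2r]]; apply: qQ; split;
      by rewrite ger0_norm// (le_trans _ r1).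
- by move=> eps e0; exact: canonical_discrete_Mnet_ex.
- move=> fe; exact: canonical_discrete_Mnet_converges.
Qed.
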